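(* Let $\mathbb{K}$ be a field of characteristic zero, $G$ a finite undirected loopless graph, and $t$ a positive integer. Then the algebras $\mathcal{B}^{F_t}_G$ and $\mathcal{C}^{F_t}_G$ are isomorphic, and their total dimension over $\mathbb{K}$ equals the number of $t$-labelled forests of $G$. Moreover, fixing a linear order on $E(G)$, the dimension of the $k$-th graded component of $\mathcal{B}^{F_t}_G$ equals the number of $t$-labelled forests $F$ of $G$ with weight $\omega(F)=t\cdot(e(G)-act_G(F))-k$.
   Context: Let $G$ have vertices $1,\dots,n$. $\Phi^{F_t}_G$ is the commutative $\mathbb{K}$-algebra generated by $\phi_e$, $e\in E(G)$, subject to $\phi_e^{t+1}=0$. Set $X_i=\sum_e c_{i,e}\phi_e$ with $c_{i,e}=1$ if $e=(i,j)$, $i<j$; $c_{i,e}=-1$ if $e=(i,j)$, $i>j$; $c_{i,e}=0$ otherwise; $\mathcal{C}^{F_t}_G$ is the subalgebra generated by $X_1,\dots,X_n$. $\mathcal{B}^{F_t}_G=\mathbb{K}[x_1,\dots,x_n]/J$ where $J$ is generated by $\left(\sum_{i\in I}x_i\right)^{tD_I+1}$ for all nonempty $I\subseteq[n]$, $D_I$ being the number of edges between $I$ and its complement; it is graded by degree. A $t$-labelled forest is a spanning forest of $G$ with a label from $\{1,\dots,t\}$ on each of its edges; its weight $\omega(F)$ is the sum of labels. For a spanning forest $F$ (ignoring labels), $act_G(F)$ is the number of edges $e\in E(G)\setminus F$ such that $F+e$ contains a cycle and $e$ is the minimal edge of that cycle in the fixed order. $e(G)$ is the number of edges. *)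

(* Defs.v *)
From HB Require Import structures.
From mathcomp Require Import all_boot all_order all_algebra.
From mathcomp Require Import ring_quotient.
From mathcomp Require Import mpoly.
From mathcomp Require Import boolp.

Set Implicit Arguments.
Unset Strict Implicit.
Unset Printing Implicit Defensive.

Import GRing.Theory.

Local Open Scope ring_scope.

(* The quotient of a commutative algebra by a proper ideal; it has the ring
   structure of {ideal_quot I}, to which the scalar multiplication is added. *)
Definition alg_quot (K : comNzRingType) (A : comAlgType K) (I : idealr A) :=
  {ideal_quot I}.

Section AlgQuot.
Variables (K : comNzRingType) (A : comAlgType K) (I : idealr A).
Local Notation Q := (alg_quot I).

HB.instance Definition _ := GRing.ComNzRing.on Q.

Definition alg_quot_pi (x : A) : Q := \pi_({ideal_quot I})%qT x.

Definition alg_quot_scale (a : K) (x : Q) : Q := alg_quot_pi (a%:A) * x.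

Fact alg_quot_piD : {morph alg_quot_pi : x y / x + y}.
Proof. exact: (rmorphD (\pi_({ideal_quot I})%qT)). Qed.

Fact alg_quot_piM : {morph alg_quot_pi : x y / x * y}.
Proof. exact: (rmorphM (\pi_({ideal_quot I})%qT)). Qed.

Fact alg_quot_pi1 : alg_quot_pi 1 = 1.
Proof. exact: (rmorph1 (\pi_({ideal_quot I})%qT)). Qed.

Fact alg_quot_scaleA a b x :
  alg_quot_scale a (alg_quot_scale b x) = alg_quot_scale (a * b) x.
Proof.
by rewrite /alg_quot_scale mulrA -alg_quot_piM -scalerAl mul1r scalerA.
Qed.

Fact alg_quot_scale1 : left_id 1 alg_quot_scale.
Proof. by move=> x; rewrite /alg_quot_scale scale1r alg_quot_pi1 mul1r. Qed.

Fact alg_quot_scaleDr : right_distributive alg_quot_scale +%R.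
Proof. by move=> a x y; rewrite /alg_quot_scale mulrDr. Qed.

Fact alg_quot_scaleDl x : {morph alg_quot_scale^~ x : a b / a + b}.
Proof. by move=> a b; rewrite /alg_quot_scale scalerDl alg_quot_piD mulrDl. Qed.

HB.instance Definition _ := GRing.Zmodule_isLmodule.Build K Q
  alg_quot_scaleA alg_quot_scale1 alg_quot_scaleDr alg_quot_scaleDl.

Fact alg_quot_scaleAl (a : K) (x y : Q) : a *: (x * y) = (a *: x) * y.
Proof. exact: mulrA. Qed.

HB.instance Definition _ := GRing.Lmodule_isLalgebra.Build K Q alg_quot_scaleAl.
HB.instance Definition _ := GRing.Lalgebra_isComAlgebra.Build K Q.

Fact alg_quot_pi_is_linear : linear alg_quot_pi.
Proof.
move=> a x y; rewrite alg_quot_piD; congr (_ + _).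
by rewrite -[in LHS](mul1r x) scalerAl alg_quot_piM.
Qed.

Fact alg_quot_pi_is_monoid_morphism : monoid_morphism alg_quot_pi.
Proof. by split; [exact: alg_quot_pi1 | exact: alg_quot_piM]. Qed.

HB.instance Definition _ := GRing.isLinear.Build K A Q *:%R alg_quot_pi
  alg_quot_pi_is_linear.
HB.instance Definition _ := GRing.isMonoidMorphism.Build A Q alg_quot_pi
  alg_quot_pi_is_monoid_morphism.

End AlgQuot.

(* A finite family of polynomials without constant term: the ideal they
   generate is proper, hence the quotient by it is a nonzero ring. *)
Record relations (K : fieldType) (n : nat) (I : finType) := Relations {
  relator :> I -> {mpoly K[n]};
  relator0 : forall i, (relator i)@_0%MM = 0
}.

Section Presentation.
Variables (K : fieldType) (n : nat) (I : finType) (g : relations K n I).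

Definition gen_ideal : {pred {mpoly K[n]}} :=
  fun p => `[< exists a : I -> {mpoly K[n]}, p = \sum_i a i * g i >].

Fact gen_ideal_closed : idealr_closed gen_ideal.
Proof.
split.
- by apply/asboolP; exists (fun=> 0); rewrite big1 // => i _; rewrite mul0r.
- apply/negP => /asboolP [a /(congr1 (mcoeff 0%MM))] /eqP.
  rewrite mcoeff1 eqxx raddf_sum big1 ?oner_eq0 //= => i _.
  by rewrite rmorphM /= relator0 mulr0.
- move=> b p q /asboolP [a ->] /asboolP [c ->]; apply/asboolP.
  exists (fun i => b * a i + c i); rewrite mulr_sumr -big_split /=.
  by apply: eq_bigr => i _; rewrite mulrDl mulrA.
Qed.

HB.instance Definition _ := isIdealr.Build {mpoly K[n]} gen_ideal
  gen_ideal_closed.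

Definition presented := alg_quot gen_ideal.

HB.instance Definition _ := GRing.ComAlgebra.on presented.

Definition presented_pi (p : {mpoly K[n]}) : presented :=
  alg_quot_pi gen_ideal p.

HB.instance Definition _ := GRing.LRMorphism.copy presented_pi
  (alg_quot_pi gen_ideal).

End Presentation.

(* The subalgebra generated by the X i is the smallest one containing them;
   subalg_of turns it into a type with the inherited algebra structure. *)
Section GeneratedSubalgebra.
Variables (K : fieldType) (A : comAlgType K) (I : Type) (X : I -> A).

Definition gen_subalg : {pred A} := fun x =>
  `[< forall S : {pred A}, subalg_closed S -> (forall i, X i \in S) -> x \in S >].

Fact gen_subalg_closed : subalg_closed gen_subalg.
Proof.
split.
- by apply/asboolP => S [].
- move=> a u v /asboolP uS /asboolP vS; apply/asboolP => S clS XS.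
  by case: (clS) => _ lS _; apply: lS; [exact: uS | exact: vS].
- move=> u v /asboolP uS /asboolP vS; apply/asboolP => S clS XS.
  by case: (clS) => _ _ mS; apply: mS; [exact: uS | exact: vS].
Qed.

HB.instance Definition _ := GRing.isSubalgClosed.Build K A gen_subalg
  gen_subalg_closed.

Record subalg_of := SubalgOf { subalg_val : A; _ : subalg_val \in gen_subalg }.

HB.instance Definition _ := [isSub for subalg_val].
HB.instance Definition _ := [Choice of subalg_of by <:].
HB.instance Definition _ := [SubChoice_isSubComNzRing of subalg_of by <:].
HB.instance Definition _ := [SubZmodule_isSubLmodule of subalg_of by <:].
HB.instance Definition _ := [SubNzRing_SubLmodule_isSubLalgebra of subalg_of by <:].
HB.instance Definition _ := [SubLalgebra_isSubAlgebra of subalg_of by <:].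

HB.instance Definition _ := GRing.RMorphism.copy subalg_val
  (\val : subalg_of -> A).
HB.instance Definition _ := GRing.Linear.copy subalg_val
  (\val : subalg_of -> A).

End GeneratedSubalgebra.

(* The dimension of the subspace U is d: a basis of U is a linearly
   independent family of d vectors whose linear combinations are exactly the
   elements of U. *)
Definition has_dim (K : fieldType) (V : lmodType K) (U : V -> Prop) (d : nat) :=
  exists b : 'I_d -> V,
    (forall c : 'I_d -> K, \sum_i c i *: b i = 0 -> forall i, c i = 0) /\
    (forall v, U v <-> exists c : 'I_d -> K, v = \sum_i c i *: b i).

(* Finite undirected loopless graphs on the vertex set 'I_n, which numbers the
   vertices from 0; parallel edges are allowed. *)
Record graph (n : nat) := Graph {
  edge : finType;
  ends : edge -> {set 'I_n};
  card_ends : forall e, #|ends e| = 2%N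
}.

Section GraphNotions.
Variables (n : nat) (G : graph n).
Implicit Types (C F : {set edge G}) (le : rel (edge G)).

Definition cut_size (I : {set 'I_n}) : nat :=
  #|[set e : edge G | (ends e :&: I != set0) && (ends e :&: ~: I != set0)]|.

(* C is the edge set of a closed walk v_0 e_0 v_1 e_1 ... v_0 with distinct
   vertices and distinct edges, given by the sequence of the (v_i, e_i); two
   parallel edges form a cycle. *)
Definition is_cycle C : Prop :=
  exists s : seq ('I_n * edge G),
    [/\ s != [::],
        uniq [seq p.1 | p <- s],
        uniq [seq p.2 | p <- s],
        cycle (fun p q => ends p.2 == [set p.1; q.1]) s
      & C = [set e in [seq p.2 | p <- s]]].

Definition is_forest F : Prop := forall C, is_cycle C -> ~~ (C \subset F).

Definition linear_order le : Prop :=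
  [/\ total le, antisymmetric le & transitive le].

Definition act le F : nat :=
  #|[set e | (e \notin F) &&
      `[< exists C, [/\ is_cycle C, C \subset e |: F, e \in C
                      & forall e', e' \in C -> le e e'] >]]|.

(* A t-labelled forest is encoded by a labelling of all the edges by
   {0, ..., t}, the label 0 marking the edges outside the forest. *)
Section Labelled.
Variable t : nat.
Implicit Type l : {ffun edge G -> 'I_t.+1}.

Definition lsupport l : {set edge G} := [set e | l e != ord0].

Definition labelled_forest : {set {ffun edge G -> 'I_t.+1}} :=
  [set l | `[< is_forest (lsupport l) >]].

Definition weight l : nat := (\sum_(e in lsupport l) l e)%N.

End Labelled.

End GraphNotions.

Section Algebras.
Variables (K : fieldType) (n : nat) (G : graph n) (t : nat).

Definition power_relator (I : {I : {set 'I_n} | I != set0}) : {mpoly K[n]} :=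
  (\sum_(i in sval I) 'X_i) ^+ (t * cut_size G (sval I)).+1%N.

Fact power_relator0 I : (power_relator I)@_0%MM = 0.
Proof.
rewrite /power_relator rmorphXn /= raddf_sum big1 ?expr0n //= => i _.
by rewrite mcoeffX mnm1_eq0.
Qed.

Definition Balg := presented (Relations power_relator0).

HB.instance Definition _ := GRing.ComAlgebra.on Balg.

(* The defining ideal is homogeneous, so the k-th graded component of the
   quotient is the image of the forms of degree k. *)
Definition Bgraded (k : nat) (x : Balg) : Prop :=
  exists2 p : {mpoly K[n]}, p \is k.-homog
    & x = presented_pi (Relations power_relator0) p.

Definition edge_relator (e : edge G) : {mpoly K[#|edge G|]} :=
  'X_(enum_rank e) ^+ t.+1.

Fact edge_relator0 e : (edge_relator e)@_0%MM = 0.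
Proof. by rewrite /edge_relator rmorphXn /= mcoeffX mnm1_eq0 expr0n. Qed.

Definition Phi := presented (Relations edge_relator0).

HB.instance Definition _ := GRing.ComAlgebra.on Phi.

Definition phi (e : edge G) : Phi :=
  presented_pi (Relations edge_relator0) 'X_(enum_rank e).

Definition coef (i : 'I_n) (e : edge G) : K :=
  if [exists j, (ends e == [set i; j]) && (i < j)%N] then 1
  else if [exists j, (ends e == [set i; j]) && (j < i)%N] then -1
  else 0.

Definition Xgen (i : 'I_n) : Phi := \sum_e coef i e *: phi e.

Definition Calg := subalg_of Xgen.

HB.instance Definition _ := GRing.ComAlgebra.on Calg.

End Algebras.

(* Main.v *)
Require Import Defs.
From HB Require Import structures.
From mathcomp Require Import all_boot all_order all_algebra.
From mathcomp Require Import ring_quotient mpoly boolp ring zify.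

Set Implicit Arguments.
Unset Strict Implicit.
Unset Printing Implicit Defensive.

Import GRing.Theory.

Local Open Scope ring_scope.

(* Let v_e = y_i - y_j for an edge e = (i, j), i < j. Under the pairing
   <p, f> = (p(d) f)(0), the coefficient of phi^b in p(X_1, ..., X_n) is
   <p, prod_e v_e^(b_e)> up to a nonzero factorial. Hence the kernel of
   K[x] -> C is the orthogonal of the span P of the products prod_e v_e^(b_e)
   with b_e <= t, while J is the orthogonal of the space Q of the f such that
   (sum_(i in I) d_i)^(t D_I + 1) f = 0 for all I. Always P is contained in Q.
   Deletion-contraction shows P = Q and yields a basis. Process the edges from
   the largest to the smallest and restrict f to y_i = y_j: this restriction
   satisfies the conditions of the contracted graph, and if it vanishes then f is
   v_e times a polynomial satisfying the conditions with one copy of e deleted.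
   Unfolding the recursion, a labelled forest F contributes the product of the
   v_e^(t - label e) over e in F and of the v_e^t over the non-active e outside F,
   whose degree is t (e(G) - act F) - weight F. *)

(** * Polynomial differential calculus and its pairing *)

(** Induction on the ring structure: an identity compatible with sums only has to be checked on
    constants and under multiplication by one variable. *)
Lemma mpoly_ring_ind (K : comNzRingType) (n : nat) (P : {mpoly K[n]} -> Prop) :
    (forall c, P c%:MP) -> (forall p q, P p -> P q -> P (p + q)) ->
    (forall i p, P p -> P ('X_i * p)) -> forall p, P p.
Proof.
move=> PC PD PX; elim/mpolyind => [|c m p _ _ IHp]; first by rewrite -mpolyC0.
apply: PD => //; rewrite mpolyXE_id -mul_mpolyC mulrC.
elim: (index_enum _) => [|i s IHs]; first by rewrite big_nil mul1r.
rewrite big_cons -mulrA; elim: (m i) => [|k IHk]; first by rewrite expr0 mul1r.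
by rewrite exprS -mulrA; apply: PX.
Qed.

Lemma mderivXU (K : comNzRingType) (n : nat) (i j : 'I_n) :
  ('X_i : {mpoly K[n]})^`M(j) = ((i == j)%:R)%:MP.
Proof.
rewrite mderivX mnm1E; case: eqP => [->|_]; last by rewrite scale0r mpolyC0.
by rewrite -{1}[U_(j)%MM]add0m addmK scale1r mpolyX0.
Qed.

Section DirectionalDerivative.
Variables (K : fieldType) (n : nat).
Implicit Types (I : {set 'I_n}) (f g p v : {mpoly K[n]}).

(** The derivative along the indicator vector of [I], adjoint to multiplication by the sum of the
    variables in [I]. *)
Definition dset I f := \sum_(i in I) f^`M(i).

Fact dset_is_linear I : linear (dset I).
Proof.
move=> a f g; rewrite /dset scaler_sumr -big_split /=.
by apply: eq_bigr => i _; rewrite linearP.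
Qed.

HB.instance Definition _ I := GRing.isLinear.Build K _ _ _ (dset I)
  (dset_is_linear I).

Lemma dsetM I f g : dset I (f * g) = dset I f * g + f * dset I g.
Proof.
rewrite /dset mulr_suml mulr_sumr -big_split /=.
by apply: eq_bigr => i _; rewrite mderivM.
Qed.

Definition diter I m f := iter m (dset I) f.

Arguments diter : simpl never.

Fact diter_is_linear I m : linear (diter I m).
Proof. by rewrite /diter; elim: m => [|m IHm] a f g //=; rewrite IHm linearP. Qed.

HB.instance Definition _ I m := GRing.isLinear.Build K _ _ _ (diter I m)
  (diter_is_linear I m).

Lemma diter0 I f : diter I 0 f = f. Proof. by []. Qed.

Lemma diterS I m f : diter I m.+1 f = dset I (diter I m f).
Proof. by []. Qed.

Lemma diterSr I m f : diter I m.+1 f = diter I m (dset I f).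
Proof. exact: iterSr. Qed.

Lemma diterD I k m f : diter I (k + m) f = diter I k (diter I m f).
Proof. exact: iterD. Qed.

(** Leibniz rule: the first derivative of [v] is constant, so only two terms survive. *)
Lemma diter_mul I c v f m : dset I v = c%:MP ->
  diter I m.+1 (v * f) =
    v * diter I m.+1 f + (c *+ m.+1) *: diter I m f.
Proof.
move=> dv; elim: m => [|m IHm].
  by rewrite !diterS !diter0 dsetM dv mul_mpolyC mulr1n addrC.
rewrite diterS IHm linearD linearZ /= -diterS dsetM dv.
by rewrite mul_mpolyC -diterS addrAC -scalerDl -mulrS addrC.
Qed.

Lemma dsetC I c : dset I c%:MP = 0.
Proof. by rewrite /dset big1 // => i _; rewrite mderivC. Qed.

Lemma dsetX I i : dset I 'X_i = ((i \in I)%:R)%:MP.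
Proof.
rewrite /dset; under eq_bigr => j _ do rewrite mderivXU.
rewrite -rmorph_sum; congr (_%:MP); case: (boolP (i \in I)) => iI.
  rewrite (bigD1 i) //= eqxx big1 ?addr0 // => j /andP[_ /negPf].
  by rewrite eq_sym => ->.
by rewrite big1 // => j jI; case: eqP iI => // ->; rewrite jI.
Qed.

Lemma dset_nilp I f : exists m, diter I m f = 0.
Proof.
elim/mpoly_ring_ind: f => [c|f g [a fa] [b gb]|i f [m fm]].
- by exists 1%N; rewrite diterS dsetC.
- exists (a + b)%N; rewrite linearD /= {1}addnC !diterD fa gb.
  by rewrite !linear0 addr0.
- exists m.+1; rewrite (diter_mul _ _ (dsetX I i)) diterS fm linear0 mulr0.
  by rewrite scaler0 addr0.
Qed.

End DirectionalDerivative.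

Arguments diter : simpl never.

Section Composition.
Variables (K : fieldType) (n k : nat) (l : n.-tuple {mpoly K[k]}).
Variable (d : 'I_n -> 'I_k -> K).
Hypothesis dl : forall j i, (tnth l j)^`M(i) = (d j i)%:MP.

Lemma mderiv_comp_linear f i :
  (f \mPo l)^`M(i) = \sum_j d j i *: (f^`M(j) \mPo l).
Proof.
elim/mpoly_ring_ind: f => [c|f g IHf IHg|j f IHf].
- rewrite comp_mpolyC mderivC big1 // => j _.
  by rewrite mderivC comp_mpoly0 scaler0.
- rewrite comp_mpolyD mderivD IHf IHg -big_split /=; apply: eq_bigr => j _.
  by rewrite mderivD comp_mpolyD scalerDr.
rewrite rmorphM /= comp_mpolyXU -tnth_nth mderivM dl IHf.
under [RHS]eq_bigr => j' _ do rewrite mderivM comp_mpolyD scalerDr.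
rewrite big_split /=; congr (_ + _); last first.
  rewrite mulr_sumr; apply: eq_bigr => j' _.
  by rewrite rmorphM /= comp_mpolyXU -tnth_nth scalerAr.
rewrite (bigD1 j) //= big1 => [|j' /negPf nj'].
  by rewrite addr0 mderivXU eqxx mul1r mul_mpolyC.
by rewrite mderivXU eq_sym nj' mpolyC0 mul0r comp_mpoly0 scaler0.
Qed.

End Composition.

(** * The apolar pairing *)

Section Pairing.
Variables (K : fieldType) (n : nat).
Implicit Types (p q f g : {mpoly K[n]}) (m : 'X_{1..n}).

Definition mfact m : nat := (\prod_i (m i)`!)%N.

(** This is [p(d) f] evaluated at 0: monomials are orthogonal, with square norm the product of the
    factorials of their exponents. *)
Definition pair p f : K := \sum_(m <- msupp p) p@_m * f@_m * (mfact m)%:R.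

Lemma pairwE k p f : (msize p <= k)%N ->
  pair p f = \sum_(m : 'X_{1..n < k}) p@_m * f@_m * (mfact m)%:R.
Proof.
move=> le_pk; pose I : subFinType _ := 'X_{1..n < k}.
rewrite /pair (ssrcomplements.big_mksub I) /=; first last.
- by move=> x /msize_mdeg_lt /leq_trans /(_ le_pk).
- exact: msupp_uniq.
rewrite big_rmcond //= => m /memN_msupp_eq0 ->.
by rewrite !mul0r.
Qed.

Fact pair_is_linear p : linear_for *%R (pair p).
Proof.
move=> a f g; rewrite /pair mulr_sumr -big_split /=; apply: eq_bigr => m _.
by rewrite mcoeffD mcoeffZ mulrDr mulrDl mulrCA !mulrA.
Qed.

HB.instance Definition _ p := GRing.isLinear.Build K _ _ _ (pair p)
  (pair_is_linear p).

Lemma pairDl p q f : pair (p + q) f = pair p f + pair q f.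
Proof.
pose k := maxn (maxn (msize p) (msize q)) (msize (p + q)).
rewrite !(@pairwE k) ?leq_max ?leqnn ?orbT // -big_split /=.
by apply: eq_bigr => m _; rewrite mcoeffD !mulrDl.
Qed.

Lemma pairZl a p f : pair (a *: p) f = a * pair p f.
Proof.
pose k := maxn (msize p) (msize (a *: p)).
rewrite !(@pairwE k) ?leq_max ?leqnn ?orbT // mulr_sumr /=.
by apply: eq_bigr => m _; rewrite mcoeffZ !mulrA.
Qed.

Lemma pairBl p q f : pair (p - q) f = pair p f - pair q f.
Proof. by rewrite pairDl -scaleN1r pairZl mulN1r. Qed.

Lemma pair_suml (J : Type) (r : seq J) (P : pred J) (F : J -> {mpoly K[n]}) f :
  pair (\sum_(j <- r | P j) F j) f = \sum_(j <- r | P j) pair (F j) f.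
Proof.
apply: (big_morph (pair^~ f)) => [p q|]; first exact: pairDl.
by rewrite /pair msupp0 big_nil.
Qed.

Lemma pairX m f : pair 'X_[m] f = f@_m * (mfact m)%:R.
Proof. by rewrite /pair msuppX big_seq1 mcoeffX eqxx mul1r. Qed.

Lemma pairC c f : pair c%:MP f = c * f@_0%MM.
Proof.
rewrite -[c%:MP]mulr1 -mpolyX0 mul_mpolyC pairZl pairX /mfact big1 ?mulr1 //.
by move=> i _; rewrite mnm0E.
Qed.

(** On monomials the factor created by the derivative is the quotient of the two factorials. *)
Lemma pair_mulX i p f : pair ('X_i * p) f = pair p f^`M(i).
Proof.
elim/mpolyind: p => [|c m p _ _ IHp].
  by rewrite mulr0 -mpolyC0 !pairC !mul0r.
rewrite mulrDr !pairDl IHp; congr (_ + _).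
rewrite -scalerAr !pairZl -mpolyXD !pairX mcoeff_mderiv addmC; congr (_ * _).
rewrite mulrnAl -mulrnAr; congr (_ * _).
rewrite -mulrnA; congr (_ *+ _).
rewrite /mfact (bigD1 i) //= [in RHS](bigD1 i) //= mnmDE mnm1E eqxx addn1 factS.
rewrite -mulnA mulnC; congr (_ * _)%N; congr (_ * _)%N.
apply: eq_bigr => j /negPf nj.
by rewrite mnmDE mnm1E eq_sym nj addn0.
Qed.

Lemma pair_mul_dset (I : {set 'I_n}) k p f :
  pair ((\sum_(i in I) 'X_i) ^+ k * p) f = pair p (diter I k f).
Proof.
elim: k f => [|k IHk] f; first by rewrite expr0 mul1r.
rewrite exprS -mulrA mulr_suml pair_suml diterSr -IHk /dset linear_sum.
by apply: eq_bigr => i _; rewrite pair_mulX.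
Qed.

End Pairing.

Section Adjoint.
Variables (K : fieldType) (n k : nat) (c : 'I_n -> 'I_k -> K).

(** For [c] the signed incidence matrix, [fwd] sends [x_i] to a lift of [X_i], and the transposed
    substitution [bwd] sends the variable of [e] to [v_e]. *)
Definition fwd : n.-tuple {mpoly K[k]} :=
  [tuple \sum_e c i e *: 'X_e | i < n].
Definition bwd : k.-tuple {mpoly K[n]} :=
  [tuple \sum_i c i e *: 'X_i | e < k].

Lemma mderiv_bwd e i : (tnth bwd e)^`M(i) = (c i e)%:MP.
Proof.
rewrite tnth_mktuple linear_sum (bigD1 i) //= big1 => [|j /negPf nj].
  by rewrite addr0 mderivZ mderivXU eqxx alg_mpolyC.
by rewrite mderivZ mderivXU nj mpolyC0 scaler0.
Qed.

(** Linear substitutions with transposed matrices are adjoint: a factor ['X_i] crosses the pairing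
    as a derivative, which the chain rule expands through [bwd]. *)
Lemma pair_adjoint p z : pair (p \mPo fwd) z = pair p (z \mPo bwd).
Proof.
elim/mpoly_ring_ind: p z => [a|p q IHp IHq|i p IHp] z.
- rewrite comp_mpolyC !pairC; congr (_ * _).
  elim/mpoly_ring_ind: z => [b|f g IHf IHg|e f IHf].
  + by rewrite comp_mpolyC !mcoeffC !eqxx.
  + by rewrite comp_mpolyD !mcoeffD IHf IHg.
  rewrite [_ \mPo _]rmorphM /= comp_mpolyXU -tnth_nth tnth_mktuple.
  have mcM m' (g h : {mpoly K[m']}) : (g * h)@_0%MM = g@_0%MM * h@_0%MM.
    exact: (rmorphM (@mcoeff m' K 0%MM)).
  rewrite !mcM mcoeffX mnm1_eq0 mul0r raddf_sum big1 ?mul0r //= => i _.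
  by rewrite mcoeffZ mcoeffX mnm1_eq0 mulr0.
- by rewrite comp_mpolyD !pairDl IHp IHq.
rewrite rmorphM /= comp_mpolyXU -tnth_nth tnth_mktuple pair_mulX.
rewrite (mderiv_comp_linear mderiv_bwd) mulr_suml pair_suml linear_sum /=.
by apply: eq_bigr => e _; rewrite -scalerAl pairZl pair_mulX IHp linearZ.
Qed.

End Adjoint.

(** * Restriction and power conditions *)

Section Substitution.
Variables (K : fieldType) (n : nat).
Implicit Types (I : {set 'I_n}) (f g : {mpoly K[n]}) (s : 'I_n -> 'I_n).

Definition subst s f : {mpoly K[n]} := f \mPo [tuple 'X_(s j) | j < n].

HB.instance Definition _ s := GRing.LRMorphism.copy (subst s)
  (comp_mpoly [tuple 'X_(s j) | j < n]).

Lemma substX s i : subst s 'X_i = 'X_(s i).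
Proof. by rewrite /subst comp_mpolyXU -tnth_nth tnth_mktuple. Qed.

Lemma dset_subst s I f :
  dset I (subst s f) = subst s (dset (s @^-1: I) f).
Proof.
have dX j i : (tnth [tuple 'X_(s j) : {mpoly K[n]} | j < n] j)^`M(i)
    = ((s j == i)%:R)%:MP by rewrite tnth_mktuple mderivXU.
rewrite /dset linear_sum /=.
under eq_bigr => i _ do rewrite /subst (mderiv_comp_linear dX).
rewrite exchange_big /= [RHS]big_mkcond; apply: eq_bigr => j _.
rewrite -scaler_suml inE -/(subst _ _); case: ifP => sj.
  rewrite (bigD1 (s j)) //= eqxx big1 ?addr0 ?scale1r // => i /andP[_ /negPf].
  by rewrite eq_sym => ->.
rewrite big1 ?scale0r // => i iI; case: eqP => // sji.
by rewrite sji iI in sj.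
Qed.

Lemma diter_subst s I f m :
  diter I m (subst s f) = subst s (diter (s @^-1: I) m f).
Proof. by elim: m => // m IHm; rewrite !diterS IHm dset_subst. Qed.

Definition redirect (a b i : 'I_n) := if i == b then a else i.

(** Modulo [y_a - y_b] the two variables may be identified. This gives divisibility by the linear
    form once the restriction vanishes. *)
Lemma subst_redirect a b f :
  exists g, f = subst (redirect a b) f + ('X_a - 'X_b) * g.
Proof.
elim/mpoly_ring_ind: f => [c|f g [f' ef] [g' eg]|i f [g ef]].
- by exists 0; rewrite /subst comp_mpolyC mulr0 addr0.
- exists (f' + g'); rewrite raddfD /= {1}ef {1}eg; ring.
pose c : {mpoly K[n]} := (i == b)%:R.
(* Obtained by expanding ['X_i * f] with ['X_i = 'X_(redirect a b i) - ('X_a - 'X_b) * c]. *)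
exists ('X_(redirect a b i) * g - c * f).
have ei : 'X_i = 'X_(redirect a b i) - ('X_a - 'X_b) * c :> {mpoly K[n]}.
  rewrite /c /redirect; case: eqP => [->|_] /=; ring.
rewrite rmorphM /= substX {1}ei mulrBl {1}ef; ring.
Qed.

End Substitution.

Section PowerConditions.
Variables (K : fieldType) (n : nat).
Hypothesis charK : [pchar K] =i pred0.
Implicit Types (D : {set 'I_n} -> nat) (f g : {mpoly K[n]}).

Lemma natr_eq0 m : (m%:R == 0 :> K) = (m == 0%N).
Proof. by move/pcharf0P: charK => ->. Qed.

(** By [pair_mul_dset], orthogonality to the ideal generated by the powers
    [(\sum_(i in I) x_i) ^+ (D I).+1]. *)
Definition inQ D f := forall I, diter I (D I).+1 f = 0.

Lemma inQ_lin D (J : Type) (r : seq J) (c : J -> K) (F : J -> {mpoly K[n]}) :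
  (forall j, inQ D (F j)) -> inQ D (\sum_(j <- r) c j *: F j).
Proof.
move=> QF I; rewrite linear_sum big1 // => j _.
by rewrite linearZ /= QF scaler0.
Qed.

Lemma inQB D f g : inQ D f -> inQ D g -> inQ D (f - g).
Proof. by move=> Qf Qg I; rewrite linearB /= Qf Qg subrr. Qed.

Lemma inQ_weaken D D' f : (forall I, D I <= D' I)%N -> inQ D f -> inQ D' f.
Proof.
by move=> le_D Qf I; rewrite -(subnK (le_D I)) -addnS diterD Qf linear0.
Qed.

Section Difference.
Variables (a b : 'I_n).

Definition separates (I : {set 'I_n}) : bool := (a \in I) != (b \in I).

Lemma dset_diff I :
  dset I ('X_a - 'X_b) = ((a \in I)%:R - (b \in I)%:R)%:MP :> {mpoly K[n]}.
Proof. by rewrite linearB /= !dsetX mpolyCB. Qed.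

(** The derivative of [y_a - y_b] along [I] vanishes unless [I] separates [a] and [b], so only those
    directions need one more derivative. *)
Lemma inQ_mul D f : inQ D f ->
  inQ (fun I => separates I + D I)%N (('X_a - 'X_b) * f).
Proof.
move=> Qf I; rewrite (diter_mul _ _ (dset_diff I)) /separates.
case: eqP => [->|_]; first by rewrite Qf subrr mul0rn scale0r mulr0 addr0.
by rewrite add1n Qf scaler0 addr0 diterS Qf linear0 mulr0.
Qed.

Lemma inQ_mulX D f m : inQ D f ->
  inQ (fun I => m * separates I + D I)%N (('X_a - 'X_b) ^+ m * f).
Proof.
move=> Qf; elim: m => [|m IHm]; first by rewrite expr0 mul1r.
rewrite exprS -mulrA; apply: inQ_weaken (inQ_mul IHm) => I.
by rewrite mulSn addnA.
Qed.

(* For d the derivative in a direction separating a and b and v = y_a - y_b: if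
   m is minimal with d^m f = 0, then d^m (v f) = m (d v) d^(m-1) f <> 0. *)
Lemma inQ_div D f : a != b ->
  inQ (fun I => separates I + D I)%N (('X_a - 'X_b) * f) -> inQ D f.
Proof.
move=> ab Qf I; have := Qf I; rewrite /separates.
have v0 : 'X_a - 'X_b != 0 :> {mpoly K[n]}.
  apply/eqP => /(congr1 (mcoeff U_(a)%MM)); rewrite mcoeffB !mcoeffXU mcoeff0.
  by rewrite eqxx eq_sym (negPf ab) subr0 => /eqP; rewrite oner_eq0.
case: eqP => [eab|nab].
  rewrite (diter_mul _ _ (dset_diff I)) eab subrr mul0rn scale0r addr0.
  by move/eqP; rewrite mulf_eq0 (negPf v0) => /eqP.
have := ex_intro (fun m => diter I m f == 0).
case: (dset_nilp I f) => m0 /eqP fm0 /(_ _ fm0) ex_m.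
case: (ex_minnP ex_m) => -[|m] /eqP fm m_min.
  by rewrite -(diter0 I f) fm linear0.
rewrite add1n; case: (leqP m (D I)) => [leDm _|ltDm].
  by rewrite -(subnK (leDm)) -addnS diterD fm linear0.
move=> Qvf; have := m_min m; rewrite ltnn; case: eqP => [_ /(_ isT) //|nfm _].
case: nfm; have := diterD I (m - (D I).+1) (D I).+2 (('X_a - 'X_b) * f).
rewrite Qvf linear0 addnS subnK // (diter_mul _ _ (dset_diff I)) fm mulr0.
rewrite add0r => /eqP; rewrite scaler_eq0 => /orP[|/eqP //].
rewrite -[_ *+ m.+1]mulr_natr mulf_eq0 natr_eq0 orbF subr_eq0.
case: (a \in I) nab; case: (b \in I) => // _; first by rewrite oner_eq0.
by rewrite eq_sym oner_eq0.
Qed.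

End Difference.

Lemma inQ_const f : inQ (fun=> 0%N) f -> f = (f@_0%MM)%:MP.
Proof.
move=> Qf; apply/mpolyP => m; rewrite mcoeffC.
case: eqP => [->|/eqP m0]; first by rewrite mulr1.
have [i mi] : exists i, m i != 0%N.
  apply/existsP; apply: contraNT m0; rewrite negb_exists => /forallP m0.
  by apply/eqP/mnmP => i; rewrite mnm0E; apply/eqP; rewrite -[_ == _]negbK m0.
(* The coefficient of [m - U_(i)] in the [i]-th derivative is [m i] times that of [m] in [f], and
   [m i] is nonzero in characteristic zero. *)
have /(congr1 (mcoeff (m - U_(i))%MM)) := Qf [set i].
rewrite diterS diter0 /dset big_set1 mcoeff_mderiv submK ?lep1mP // mcoeff0 mulr0.
by rewrite -mulr_natr => /eqP; rewrite mulf_eq0 natr_eq0 orbF => /eqP.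
Qed.

End PowerConditions.

(** * Deletion-contraction *)

Section Labels.
Variables (n : nat) (E : eqType) (lo hi : E -> 'I_n) (t : nat).
Implicit Types (q r : 'I_n -> 'I_n) (e : E) (s : seq E) (w : seq nat).

(* The map r sends a vertex to its representative after the contractions made so
   far, and a word w lists the labels of the edges of s in order: label 0 deletes
   the edge, a positive label contracts it. Loops only get the label 0. *)
Definition contract r e j : 'I_n -> 'I_n :=
  if j == 0%N then r else fun i => redirect (r (lo e)) (r (hi e)) (r i).

Definition choices r e : seq nat :=
  if r (lo e) == r (hi e) then [:: 0%N] else iota 0 t.+1.

(** The exponent of the linear form of [e]: a deleted edge carries the full power [t], unless it has
    become a loop and contributes nothing. *)
Definition expo r e j : nat :=
  if r (lo e) == r (hi e) then 0%N else (t - j)%N.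

Fixpoint labs r s : seq (seq nat) :=
  if s is e :: s' then
    [seq j :: w | j <- choices r e, w <- labs (contract r e j) s']
  else [:: [::]].

Fixpoint labdeg r s w : nat :=
  if s is e :: s' then
    if w is j :: w' then (expo r e j + labdeg (contract r e j) s' w')%N else 0%N
  else 0%N.

Lemma mem_labs_nil r w : (w \in labs r [::]) = (w == [::]).
Proof. by rewrite inE. Qed.

Lemma mem_labs_cons r e s j w :
  (j :: w \in labs r (e :: s)) =
    (j \in choices r e) && (w \in labs (contract r e j) s).
Proof.
apply/allpairsPdep/andP => [[j' [w' [? ? [-> ->]]]] //|[? ?]].
by exists j, w.
Qed.

Lemma size_labs r s w : w \in labs r s -> size w = size s.
Proof.
elim: s r w => [|e s IHs] r w; first by rewrite mem_labs_nil => /eqP->.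
case/allpairsPdep => j [w' [_ /IHs ew' ->]] /=.
by rewrite ew'.
Qed.

Lemma labs_uniq r s : uniq (labs r s).
Proof.
elim: s r => [|e s IHs] r //=; apply: allpairs_uniq_dep => //.
  by rewrite /choices; case: ifP => // _; apply: iota_uniq.
by move=> [j w] [j' w'] _ _ /= [-> ->].
Qed.

Lemma big_labs_cons (R : Type) (idx : R) (op : Monoid.law idx) r e s
    (F : seq nat -> R) :
  \big[op/idx]_(w <- labs r (e :: s)) F w =
    \big[op/idx]_(j <- choices r e)
      \big[op/idx]_(w <- labs (contract r e j) s) F (j :: w).
Proof. by rewrite /= big_allpairs_dep. Qed.

Section Products.
Variable K : fieldType.

Definition form q e : {mpoly K[n]} := 'X_(q (lo e)) - 'X_(q (hi e)).

(** The map [r] decides which edges have become loops, while [q] names the variables of the forms.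
    They are separate because restriction changes only [q] and the recursion changes only [r]. *)
Fixpoint labprod q r s w : {mpoly K[n]} :=
  if s is e :: s' then
    if w is j :: w' then
      form q e ^+ expo r e j * labprod q (contract r e j) s' w' else 1
  else 1.

Lemma subst_form (f : 'I_n -> 'I_n) q e :
  subst f (form q e) = form (fun i => f (q i)) e.
Proof. by rewrite /form linearB /= !substX. Qed.

Lemma subst_labprod (f : 'I_n -> 'I_n) q r s w :
  subst f (labprod q r s w) = labprod (fun i => f (q i)) r s w.
Proof.
elim: s r w => [|e s IHs] r [|j w] /=; rewrite ?rmorph1 //.
by rewrite rmorphM rmorphXn /= subst_form IHs.
Qed.

Lemma form_homog q e : form q e \is 1.-homog.
Proof.
by rewrite /form rpredB // dhomogX; apply/eqP; exact: mdeg1.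
Qed.

Lemma labprod_homog q r s w : labprod q r s w \is (labdeg r s w).-homog.
Proof.
elim: s r w => [|e s IHs] r [|j w] /=; rewrite ?dhomog1 //.
apply: dhomogM => //.
by have := dhomogMn (expo r e j) (form_homog q e); rewrite mul1n.
Qed.

End Products.
End Labels.

(** * Independence and spanning of the edge products *)

Section Basis.
Variables (K : fieldType) (n : nat) (E : eqType) (lo hi : E -> 'I_n) (t : nat).
Hypothesis charK : [pchar K] =i pred0.
Implicit Types (q r : 'I_n -> 'I_n) (e : E) (s : seq E) (w : seq nat).

Local Notation labs := (labs lo hi t).
Local Notation contract := (contract lo hi).
Local Notation labprod := (labprod lo hi t K).
Local Notation form := (form lo hi K).

Definition cut r s (I : {set 'I_n}) : nat :=
  (\sum_(e <- s) separates (r (lo e)) (r (hi e)) I)%N.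

Lemma labprod_inQ q r s w : inQ (fun I => t * cut q s I)%N (labprod q r s w).
Proof.
elim: s r w => [|e s IHs] r w.
  by move=> I; rewrite /cut big_nil muln0 /= diterS diter0 -mpolyC1 dsetC.
case: w => [|j w].
  apply: (@inQ_weaken _ _ (fun=> 0%N)) => // I.
  by rewrite diterS diter0 /= -mpolyC1 dsetC.
apply: inQ_weaken (inQ_mulX (q (lo e)) (q (hi e)) (expo lo hi t r e j) (IHs _ w)).
move=> I; rewrite /cut big_cons mulnDr leq_add2r leq_mul2r; apply/orP; right.
by rewrite /expo; case: ifP => // _; apply: leq_subr.
Qed.

Lemma subst_contract_form0 r e : r (lo e) != r (hi e) ->
  subst (redirect (r (lo e)) (r (hi e))) (form r e) = 0.
Proof.
move=> nl; rewrite subst_form /form /redirect eqxx (negPf nl).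
by rewrite subrr.
Qed.

Lemma form_neq0 r e : r (lo e) != r (hi e) -> form r e != 0.
Proof.
move=> nl; apply/eqP => /(congr1 (mcoeff U_(r (lo e))%MM)).
rewrite mcoeffB !mcoeffXU mcoeff0 eqxx eq_sym (negPf nl) subr0 => /eqP.
by rewrite oner_eq0.
Qed.

(** Uniqueness of an expansion in powers of [v]: applying [S] isolates the top term [A m], and once
    it is zero the rest can be divided by [v]. *)
Lemma adic_sum_eq0 (S : {rmorphism {mpoly K[n]} -> {mpoly K[n]}}) v
    (A : nat -> {mpoly K[n]}) m :
    v != 0 -> S v = 0 -> (forall j, j != 0%N -> S (A j) = 0 -> A j = 0) ->
    \sum_(j <- iota 0 m.+1) v ^+ (m - j) * A j = 0 ->
  forall j, (j <= m)%N -> A j = 0.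
Proof.
move=> v0 Sv SA; elim: m => [|m IHm].
  by rewrite big_seq1 mul1r => A0 j; rewrite leqn0 => /eqP->.
rewrite -[m.+2]addn1 iotaD big_cat big_seq1 add0n /= subnn mul1r.
have -> : \sum_(j <- iota 0 m.+1) v ^+ (m.+1 - j) * A j =
    v * \sum_(j <- iota 0 m.+1) v ^+ (m - j) * A j.
  rewrite mulr_sumr big_seq [RHS]big_seq; apply: eq_bigr => j.
  by rewrite mem_iota /= ltnS => lejm; rewrite subSn // exprS mulrA.
move=> sum0; have Am : A m.+1 = 0.
  apply: SA => //; have /(congr1 S) := sum0.
  by rewrite rmorphD rmorphM /= Sv mul0r add0r rmorph0.
move/eqP: sum0; rewrite Am addr0 mulf_eq0 (negPf v0) /= => /eqP /IHm Aj j.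
by rewrite leq_eqVlt => /orP[/eqP-> //|]; apply: Aj.
Qed.

(** Grouped by the label of the first edge, the sum is an expansion in powers of its form. The
    groups with positive label restrict to products of the contracted graph, the group of label 0
    belongs to the deletion, and induction applies to both. *)
Lemma labprod_indep r s (c : seq nat -> K) :
    \sum_(w <- labs r s) c w *: labprod r r s w = 0 ->
  forall w, w \in labs r s -> c w = 0.
Proof.
elim: s r c => [|e s IHs] r c.
  rewrite /= big_seq1 => /eqP; rewrite scaler_eq0 oner_eq0 orbF => /eqP c0 w.
  by rewrite inE => /eqP->.
rewrite big_labs_cons.
pose A j := \sum_(w <- labs (contract r e j) s)
              c (j :: w) *: labprod r (contract r e j) s w.
have IHA j w : (j == 0%N) || (r (lo e) != r (hi e)) -> A j = 0 ->
    w \in labs (contract r e j) s -> c (j :: w) = 0.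
  rewrite {}/A; case: eqP => [-> _|/eqP/negPf j0 /= nl].
    by move=> A0; apply: (IHs r (fun w => c (0%N :: w)) A0).
  move/(congr1 (subst (redirect (r (lo e)) (r (hi e))))).
  rewrite linear_sum linear0 /= => sum0.
  move: w; apply: (IHs _ (fun w => c (j :: w))); rewrite -[RHS]sum0.
  apply: eq_bigr => w' _; rewrite linearZ /= subst_labprod.
  by rewrite {1}/contract j0.
have -> : \sum_(j <- choices lo hi t r e) \sum_(w <- labs (contract r e j) s)
    c (j :: w) *: labprod r r (e :: s) (j :: w) =
    \sum_(j <- choices lo hi t r e) form r e ^+ expo lo hi t r e j * A j.
  apply: eq_bigr => j _; rewrite mulr_sumr; apply: eq_bigr => w _ /=.
  by rewrite scalerAr.
move=> sum0 [|j w]; first by move/size_labs.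
rewrite mem_labs_cons => /andP[jc]; apply: IHA; last first.
  move: sum0 jc; rewrite /choices /expo; case: ifP => [_|/negbT nl].
    by rewrite big_seq1 mul1r inE => + /eqP->.
  move=> sum0; rewrite mem_iota add0n ltnS /=; move: j.
  apply: adic_sum_eq0 sum0.
  - exact: form_neq0 nl.
  - exact: (subst_contract_form0 nl).
  move=> j j0; rewrite /= {}/A linear_sum /= => sum0.
  rewrite big_seq big1 // => w' w's.
  have := IHs _ (fun w => c (j :: w)) _ w' w's => ->; first by rewrite scale0r.
  rewrite -[RHS]sum0; apply: eq_bigr => w1 _; rewrite linearZ /= subst_labprod.
  by rewrite {1}/contract (negPf j0).
by move: jc; rewrite /choices; case: ifP => _; rewrite ?orbT // inE orbF.
Qed.

Lemma cut_contract r e s I j : j != 0%N ->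
  cut (contract r e j) s I =
    cut r s (redirect (r (lo e)) (r (hi e)) @^-1: I).
Proof.
move=> /negPf j0; apply: eq_bigr => e' _.
by rewrite /separates /contract j0 !inE.
Qed.

(** Derivatives of the restriction along [I] come from the preimage of [I] under the contraction,
    which never separates the ends of [e]; the term of [e] drops out. *)
Lemma inQ_subst_contract r e s m (f : {mpoly K[n]}) : r (lo e) != r (hi e) ->
  inQ (fun I => m * separates (r (lo e)) (r (hi e)) I + t * cut r s I)%N f ->
  inQ (fun I => t * cut (contract r e 1) s I)%N
      (subst (redirect (r (lo e)) (r (hi e))) f).
Proof.
move=> nl Qf I; rewrite diter_subst cut_contract //.
set J := _ @^-1: I; have := Qf J.
have -> : separates (r (lo e)) (r (hi e)) J = false.
  by rewrite /separates !inE /redirect eqxx (negPf nl) eqxx.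
by rewrite muln0 add0n => ->; rewrite linear0.
Qed.

(* Peeling off one copy of the edge e at a time: the restriction of f to
   y_(lo e) = y_(hi e) satisfies the conditions of the contracted graph, and
   what is left of f is divisible by the linear form of e. *)
Lemma labprod_span r s (f : {mpoly K[n]}) : inQ (fun I => t * cut r s I)%N f ->
  exists c : seq nat -> K, f = \sum_(w <- labs r s) c w *: labprod r r s w.
Proof.
elim: s r f => [|e s IHs] r f Qf.
  exists (fun=> f@_0%MM); rewrite /= big_seq1 -mul_mpolyC mulr1.
  by apply: inQ_const => // I; have := Qf I; rewrite /cut big_nil muln0.
have {Qf} : inQ (fun I => t * separates (r (lo e)) (r (hi e)) I + t * cut r s I)%N f.
  by move=> I; rewrite -mulnDr; have := Qf I; rewrite /cut big_cons.
under eq_exists => c do rewrite big_labs_cons /choices /=.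
rewrite /expo; case: ifP => [/eqP loop|/negbT nl].
  move=> Qf; have /IHs[c ->] : inQ (fun I => t * cut r s I)%N f.
    by apply: inQ_weaken Qf => I; rewrite /separates loop eqxx muln0.
  exists (fun w => c (behead w)); rewrite big_seq1.
  by apply: eq_bigr => w _; rewrite mul1r.
(* Only the multiplicity of [e] varies in this induction; the other edges keep [t]. *)
elim: {1 3 5}t f => [|m IHm] f Qf.
  have /IHs[c ->] : inQ (fun I => t * cut r s I)%N f.
    by apply: inQ_weaken Qf => I; rewrite mul0n.
  exists (fun w => c (behead w)); rewrite big_seq1.
  by apply: eq_bigr => w _; rewrite mul1r.
pose S := @subst K n (redirect (r (lo e)) (r (hi e))).
have [c Sf] := IHs _ _ (inQ_subst_contract nl Qf).
(* All positive labels contract alike. The label [m.+1] has exponent [m.+1 - m.+1 = 0], so [A]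
   enters without a factor. *)
pose r' := contract r e m.+1.
have er' : r' = contract r e 1 by [].
pose A := \sum_(w <- labs r' s) c w *: labprod r r' s w.
have SfA : S (f - A) = 0.
  apply/eqP; rewrite /S linearB subr_eq0 /= Sf /A linear_sum -er'.
  apply/eqP; apply: eq_bigr => w _; rewrite linearZ /= subst_labprod.
  by rewrite {1}/r' {1}/contract.
have [g efA] := subst_redirect (r (lo e)) (r (hi e)) (f - A).
rewrite -/S SfA add0r in efA.
have /IHm[c' eg] : inQ (fun I =>
    m * separates (r (lo e)) (r (hi e)) I + t * cut r s I)%N g.
  apply: (inQ_div charK nl); rewrite -efA; apply: inQB.
    by apply: inQ_weaken Qf => I; rewrite mulSn addnA.
  apply: (@inQ_weaken _ _ (fun I => t * cut r s I)%N) => [I|].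
    by rewrite addnA leq_addl.
  by apply: inQ_lin => w; apply: labprod_inQ.
exists (fun w => if head 0%N w == m.+1 then c (behead w) else c' w).
rewrite -[0%N :: _]/(iota 0 m.+2).
rewrite -[m.+2]addn1 iotaD big_cat big_seq1 add0n /= eqxx subnn.
under [X in _ + X]eq_bigr => w _ do rewrite mul1r.
rewrite -[LHS](subrK A) efA; congr (_ + _).
rewrite {1}eg mulr_sumr big_seq [RHS]big_seq; apply: eq_bigr => j.
rewrite -[_ \in _]/(j \in iota 0 m.+1) mem_iota /= ltnS => lejm.
rewrite mulr_sumr; apply: eq_bigr => w _.
by rewrite -scalerAr subSn // exprS mulrA ltn_eqF.
Qed.

End Basis.

(** * Forests and activity *)

Section Endpoints.
Variables (n : nat) (G : graph n).
Implicit Types (F : {set edge G}) (e : edge G).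

Lemma ends_ordered (e : edge G) : exists p : 'I_n * 'I_n,
  (ends e == [set p.1; p.2]) && (p.1 < p.2)%N.
Proof.
have /eqP/cards2P[x [y [nxy ->]]] := card_ends e.
case: (ltngtP x y) => [lt|lt|/val_inj eq]; last by rewrite eq eqxx in nxy.
- by exists (x, y); rewrite eqxx.
- by exists (y, x); rewrite /= setUC eqxx.
Qed.

Definition lo (e : edge G) : 'I_n := (xchoose (ends_ordered e)).1.
Definition hi (e : edge G) : 'I_n := (xchoose (ends_ordered e)).2.

Lemma endsE e : ends e = [set lo e; hi e].
Proof. by have /andP[/eqP] := xchooseP (ends_ordered e). Qed.

Lemma lo_lt_hi e : (lo e < hi e)%N.
Proof. by have /andP[] := xchooseP (ends_ordered e). Qed.

Lemma lo_neq_hi e : lo e != hi e.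
Proof. by rewrite -val_eqE ltn_eqF // lo_lt_hi. Qed.

Lemma ends_eq2 e x y : ends e = [set x; y] ->
  (x = lo e /\ y = hi e) \/ (x = hi e /\ y = lo e).
Proof.
move=> eqe; have := card_ends e; rewrite eqe cards2 => -[].
have := set22 x y; have := set21 x y; rewrite -eqe endsE.
move=> /set2P[] -> /set2P[] ->; rewrite ?eqxx //; auto.
Qed.

Definition adj (F : {set edge G}) : rel 'I_n :=
  fun x y => [exists e in F, ends e == [set x; y]].

Definition conn F := connect (adj F).

Lemma adj_sym F : ssrbool.symmetric (adj F).
Proof. by move=> x y; rewrite /adj setUC. Qed.

Lemma conn_sym F : ssrbool.symmetric (conn F).
Proof. exact: sym_connect_sym (adj_sym F). Qed.

Lemma conn_subset F F' x y : F \subset F' -> conn F x y -> conn F' x y.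
Proof.
move/subsetP => sF; apply: connect_sub => u v /exists_inP[e eF euv].
by apply/connect1/exists_inP; exists e => //; apply: sF.
Qed.

Lemma conn_trans F x y z : conn F x y -> conn F y z -> conn F x z.
Proof. exact: connect_trans. Qed.

Lemma conn_edge F e : e \in F -> conn F (lo e) (hi e).
Proof. by move=> eF; apply/connect1/exists_inP; exists e => //; rewrite endsE. Qed.

Local Notation walk := (fun p q : 'I_n * edge G => ends p.2 == [set p.1; q.1]).

Lemma walk_conn F q s p : all (fun p => p.2 \in F) (q :: s) ->
  path walk q (rcons s p) -> conn F q.1 p.1.
Proof.
elim: s q => [|q' s IHs] q /= /andP[qF sF] /andP[wq].
  by move=> _; apply/connect1/exists_inP; exists q.2.
move=> /(IHs _ sF); apply: connect_trans.
by apply/connect1/exists_inP; exists q.2.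
Qed.

(** The clause on [ends] makes the edges distinct: the first edge contains [x], which lies off the
    rest of the path. The last clause leaves the final vertex free, so that the walk can be
    closed. *)
Lemma conn_walk F x p : path (adj F) x p -> uniq (x :: p) ->
  exists s : seq ('I_n * edge G),
    [/\ [seq y.1 | y <- s] = belast x p, uniq [seq y.2 | y <- s],
        all (fun y => y.2 \in F) s,
        (forall y, y \in s -> ends y.2 \subset x :: p)
      & forall q, q.1 = last x p -> sorted walk (rcons s q)].
Proof.
elim: p x => [|y p IHp] x /=; first by exists [::].
case/andP => /exists_inP[e eF /eqP eE] yp /andP[xNyp Uyp].
have [s [s1 Us sF sV sW]] := IHp y yp Uyp.
exists ((x, e) :: s); split=> /=.
- by rewrite s1.
- rewrite Us andbT; apply/mapP => -[q /sV/subsetP/(_ x) sVx eq].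
  by move: sVx; rewrite -eq eE set21 (negPf xNyp) => /(_ isT).
- by rewrite eF.
- move=> q; rewrite inE => /orP[/eqP->|/sV].
    by apply/subsetP => z; rewrite eE !inE => /orP[]->; rewrite ?orbT.
  by move=> /subsetP sq; apply/subsetP => z /sq; rewrite !inE => ->; rewrite orbT.
move=> q qE; have := sW q qE; case: s s1 {Us sF sV sW} => [|q' s] /=.
  by case: p {IHp yp Uyp xNyp} qE => //= -> _ _; rewrite eE eqxx.
case: p {IHp yp Uyp xNyp} qE => //= z p _ [-> _] ->.
by rewrite eE eqxx.
Qed.

Lemma cycle_conn F e : e \notin F ->
  (exists C, [/\ is_cycle C, C \subset e |: F & e \in C]) <->
  conn F (lo e) (hi e).
Proof.
move=> eF; split=> [[C [[s [s0 U1 U2 cs ->]] /subsetP sF]]|].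
  (* Rotate the cycle so that it starts with [e]; the remainder is a walk in [F] joining the ends of
     [e]. *)
  rewrite inE => /mapP[p ps ep]; have [k s' es'] := rot_to ps.
  have : cycle walk (rot k s) by rewrite rot_cycle.
  have : uniq [seq y.2 | y <- rot k s] by rewrite map_rot rot_uniq.
  rewrite es' /= => {cs}U2.
  have {sF} sF : forall q, q \in p :: s' -> q.2 \in e |: F.
    by move=> q; rewrite -es' mem_rot => qs; apply: sF; rewrite inE map_f.
  case: s' sF U2 {es'} => [_ _|q s' sF /= U2] /=.
    rewrite -ep andbT setUid => /eqP e1; have := card_ends e.
    by rewrite e1 cards1.
  case/andP; rewrite -ep => /eqP/ends_eq2 epq ws.
  move: U2; rewrite inE negb_or -ep => /andP[/andP[neq nes] _].
  have /walk_conn/(_ ws) : all (fun y => y.2 \in F) (q :: s').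
    apply/allP => y ys; have := sF y; rewrite [y \in _]inE ys orbT => /(_ isT).
    rewrite !inE => /orP[/eqP ye|//].
    move: ys; rewrite inE => /orP[/eqP yq|ys].
      by rewrite -yq ye eqxx in neq.
    by case/negP: nes; rewrite -ye map_f.
  by case: epq => -[-> ->] //; rewrite conn_sym.
case/connectP => p0 /shortenP[p pp Up _] lastp {p0}.
have [s [s1 U2 sF sV sW]] := conn_walk pp Up.
(* The edge [e], walked from [hi e] back to [lo e], closes the simple path. *)
pose q := (hi e, e).
have s_neq0 : s <> [::].
  move=> s0; move: s1; rewrite s0; case: p lastp {pp Up sV sW} => // /esym/eqP.
  by rewrite (negPf (lo_neq_hi e)).
exists [set f in [seq y.2 | y <- q :: s]]; split; last by rewrite !inE eqxx.
- exists (q :: s); split=> //.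
  + by move: Up; rewrite lastI -lastp -s1 rcons_uniq /= => ->.
  + rewrite /= U2 andbT; apply/mapP => -[y /(allP sF) + ey].
    by rewrite -ey (negPf eF).
  have := sW q lastp; case: s s1 s_neq0 {U2 sF sV sW} => // y s.
  case: p lastp {pp Up} => // z p _ [y1 _] _ /= ->.
  by rewrite y1 endsE setUC eqxx.
- apply/subsetP => f; rewrite !inE => /orP[->//|/mapP[y /(allP sF) + ->]].
  by move=> ->; rewrite orbT.
Qed.

(** If the fibres of [r] are the components of [F], redirecting one representative merges exactly
    the two components joined by [e]. *)
Lemma conn_add F e (r : 'I_n -> 'I_n) :
  (forall x y, (r x == r y) = conn F x y) -> r (lo e) != r (hi e) ->
  forall x y, (contract lo hi r e 1 x == contract lo hi r e 1 y)
    = conn (e |: F) x y.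
Proof.
move=> rF nl x y; rewrite /contract /=.
have sF : F \subset e |: F by apply: subsetUr.
have cF u v : r u == r v -> conn (e |: F) u v.
  by rewrite rF; apply: conn_subset sF.
have ce : conn (e |: F) (lo e) (hi e) by apply: conn_edge; rewrite setU11.
apply/idP/idP.
  have chi z u : r z = r (hi e) -> r (lo e) == r u -> conn (e |: F) z u.
    move=> rz /cF; apply: conn_trans; rewrite conn_sym.
    by apply: conn_trans ce _; apply: cF; rewrite rz.
  rewrite /redirect.
  case: (eqVneq (r x) _) => [rx|_]; case: (eqVneq (r y) _) => [ry|_].
  - by move=> _; apply: cF; rewrite rx ry.
  - exact: chi.
  - by rewrite eq_sym conn_sym; apply: chi.
  - exact: cF.
case/connectP => p + ->; elim: p x => //= z p IHp x /andP[+ /IHp /eqP <-] {IHp}.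
case/exists_inP => f; rewrite inE => /orP[/set1P->|fF] /eqP.
  by case/ends_eq2 => -[-> ->]; rewrite /redirect !eqxx (negPf nl).
move=> fxz; have /eqP-> // : r x == r z.
by rewrite rF; apply/connect1/exists_inP; exists f => //; apply/eqP.
Qed.

End Endpoints.

Arguments lo {n G}.
Arguments hi {n G}.

(** * Activity and the decreasing order of processing *)

Section Activity.
Variables (n : nat) (G : graph n) (le : rel (edge G)).
Hypothesis le_order : linear_order le.
Implicit Types (F U : {set edge G}) (e : edge G) (s : seq (edge G)).

Let le_total : total le. Proof. by case: le_order. Qed.
Let le_anti : antisymmetric le. Proof. by case: le_order. Qed.
Let le_trans : transitive le. Proof. by case: le_order. Qed.
Let le_refl e : le e e. Proof. by have := le_total e e; rewrite orbb. Qed.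

Definition above e : {set edge G} := [set f | le e f && (f != e)].

(** For [e] outside [F] this is activity; for [e] in [F] it says that [e] is the least edge of a
    cycle in [F]. *)
Definition dep F e : bool := conn (F :&: above e) (lo e) (hi e).

Lemma activeP F e :
  (exists C, [/\ is_cycle C, C \subset e |: F, e \in C
                & forall e', e' \in C -> le e e']) <-> dep F e.
Proof.
have eNF : e \notin F :&: above e by rewrite !inE eqxx !andbF.
split=> [[C [cC /subsetP CF eC minC]]|/(cycle_conn eNF)[C [cC /subsetP CF eC]]].
  apply/(cycle_conn eNF); exists C; split=> //; apply/subsetP => f fC.
  have := CF f fC; rewrite !inE => /orP[->//|->].
  by rewrite minC //= orbN.
exists C; split=> // [|f /CF]; last first.
  by rewrite !inE => /orP[/eqP->|/and3P[]].
by apply/subsetP => f /CF; rewrite !inE => /orP[->|/andP[->]] //; rewrite orbT.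
Qed.

(** A cycle inside [F] is detected at its least edge. *)
Lemma is_forestP F : is_forest F <-> forall e, e \in F -> ~~ dep F e.
Proof.
split=> [fF e eF|depF C cC].
  apply/negP => /activeP[C [cC CF eC _]]; have /negP[] := fF C cC.
  by apply: subset_trans CF _; rewrite subUset sub1set eF subxx.
apply/negP => CF.
have [e eC minC] : exists2 e, e \in C & forall f, f \in C -> le e f.
  have C0 : C != set0.
    case: cC => s [+ _ _ _ ->]; case: s => // p s _; apply/set0Pn.
    by exists p.2; rewrite !inE eqxx.
  have memC : sort le (enum C) =i C by move=> f; rewrite mem_sort mem_enum.
  have := sort_sorted le_total (enum C); move: memC.
  case: (sort le _) => [C0'|e s memC /= /(order_path_min le_trans)/allP min_e].
    by case/set0Pn: C0 => f; rewrite -C0'.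
  exists e => [|f]; first by rewrite -memC inE eqxx.
  by rewrite -memC inE => /orP[/eqP->|/min_e].
have /negP[] := depF e (subsetP CF e eC); apply/activeP; exists C; split=> //.
by apply: subset_trans CF _; apply: subsetUr.
Qed.

Lemma actE F : act le F = #|[set e | (e \notin F) && dep F e]|.
Proof.
apply: eq_card => e; rewrite !inE; congr (_ && _).
by apply/asboolP/idP => /activeP.
Qed.

Section Processing.
Variables (t : nat) (l : edge G -> nat).
Hypothesis l_le_t : forall e, (l e <= t)%N.

Let F := [set e | l e != 0%N].

(** Invariant of the recursion: [U] holds the processed edges and [r] represents the components of
    [F :&: U]. Edges come in decreasing order, so [F :&: U] is the part of [F] above the next edge,
    which is a loop exactly when [dep] holds. *)
Lemma labs_processed s U (r : 'I_n -> 'I_n) :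
    sorted (fun x y => le y x) s -> uniq s -> (forall e, (e \in U) = (e \notin s)) ->
    (forall e f, e \in s -> f \in U -> le e f) ->
    (forall x y, (r x == r y) = conn (F :&: U) x y) ->
  [/\ ([seq l e | e <- s] \in labs lo hi t r s)
        = all (fun e => (e \in F) ==> ~~ dep F e) s
    & all (fun e => (e \in F) ==> ~~ dep F e) s ->
      labdeg lo hi t r s [seq l e | e <- s] =
        (\sum_(e <- s) if e \in F then t - l e else if dep F e then 0 else t)%N].
Proof.
elim: s U r => [|e s IHs] U r; first by rewrite mem_labs_nil /= big_nil.
move=> /= s_sorted /andP[eNs Us] Uc sU rU.
have e_max f : f \in s -> le f e.
  have ge_trans : transitive (fun x y => le y x).
    by move=> y x z yx zy; apply: le_trans zy yx.
  by move=> fs; have /allP := order_path_min ge_trans s_sorted; apply.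
have FU : F :&: U = F :&: above e.
  apply/setP => f; rewrite !inE; case: (l f != 0%N) => //=.
  rewrite Uc inE; apply/norP/andP => [[fe fs]|[ef fe]].
    by split=> //; apply: sU; rewrite ?mem_head // Uc inE negb_or fe.
  split=> //; apply/negP => /e_max fe'; case/eqP: fe.
  by apply: le_anti; rewrite fe' ef.
have depE : dep F e = (r (lo e) == r (hi e)) by rewrite /dep -FU rU.
have Uc' f : (f \in e |: U) = (f \notin s).
  by rewrite !inE Uc inE negb_or; case: eqP => [->|] //=; rewrite eNs.
have sU' f g : f \in s -> g \in e |: U -> le f g.
  move=> fs; rewrite !inE => /orP[/eqP->|]; first exact: e_max.
  by apply: sU; rewrite inE fs orbT.
rewrite mem_labs_cons big_cons.
have [eF|eF] := boolP (e \in F); last first.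
  have l0 : l e = 0%N by move: eF; rewrite inE negbK => /eqP.
  have FU' : F :&: (e |: U) = F :&: U.
    apply/setP => f; rewrite !inE; case: (eqVneq f e) => [->|//].
    by rewrite l0.
  rewrite l0; have [|-> IHd] := IHs (e |: U) r (path_sorted s_sorted) Us Uc' sU'.
    by move=> x y; rewrite FU' rU.
  split=> [|/IHd ->]; first by rewrite /choices; case: ifP.
  by rewrite /expo depE; case: ifP => // _; rewrite subn0.
have l0 : l e != 0%N by move: eF; rewrite inE.
rewrite depE /choices /expo; have [loop|nl] := eqVneq.
  by rewrite inE (negPf l0).
have -> : contract lo hi r e (l e) = contract lo hi r e 1.
  by rewrite /contract (negPf l0).
have [|-> IHd] :=
    IHs (e |: U) (contract lo hi r e 1) (path_sorted s_sorted) Us Uc' sU'.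
  have -> : F :&: (e |: U) = e |: (F :&: U).
    apply/setP => f; rewrite !inE; case: (eqVneq f e) => [->|//].
    by rewrite l0.
  exact: conn_add.
split=> [|/IHd -> //]; by rewrite mem_iota add0n ltnS l_le_t.
Qed.

End Processing.

Definition eseq : seq (edge G) := sort (fun x y => le y x) (enum (edge G)).

Lemma mem_eseq e : e \in eseq.
Proof. by rewrite mem_sort mem_enum. Qed.

Lemma eseq_uniq : uniq eseq.
Proof. by rewrite sort_uniq enum_uniq. Qed.

Variable t : nat.
Implicit Type l : {ffun edge G -> 'I_t.+1}.

Definition word l : seq nat := [seq l e : nat | e <- eseq].

Lemma word_inj : injective word.
Proof.
move=> l l' /eq_in_map ell'; apply/ffunP => e; apply: val_inj.
exact: ell' (mem_eseq e).
Qed.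

(** Each edge contributes [t] in all to the degree identity: [t - l e] and [l e] on the forest, the
    activity term on an active edge, the degree on any other edge. *)
Lemma labs_eseq l :
  (word l \in labs lo hi t id eseq) = (l \in labelled_forest G t) /\
  (l \in labelled_forest G t ->
     labdeg lo hi t id eseq (word l) + weight l + t * act le (lsupport l)
       = t * #|edge G|)%N.
Proof.
have lt e : (l e <= t)%N by rewrite -ltnS.
have lF : lsupport l = [set e | (l e : nat) != 0%N] by apply/setP => e; rewrite !inE.
have [|||||mem_l deg_l] := labs_processed (s := eseq) (U := set0) (r := id) lt.
- by apply: sort_sorted => x y; apply: le_total.
- exact: eseq_uniq.
- by move=> e; rewrite inE mem_eseq.
- by move=> e f _; rewrite inE.
- move=> x y; rewrite setI0; apply/eqP/idP => [->|]; first exact: connect0.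
  case/connectP => -[_ ->//|z p /= /andP[/exists_inP[e]]].
  by rewrite inE.
rewrite -lF in mem_l deg_l.
have allE : all (fun e => (e \in lsupport l) ==> ~~ dep (lsupport l) e) eseq
    = (l \in labelled_forest G t).
  rewrite inE; apply/allP/asboolP => [al|/is_forestP al e _].
    by apply/is_forestP => e; apply/implyP/al/mem_eseq.
  by apply/implyP/al.
split; first by rewrite mem_l.
rewrite -allE => al; rewrite deg_l //.
have eseqE (P : edge G -> nat) : (\sum_(e <- eseq) P e = \sum_e P e)%N.
  by rewrite (perm_big _ (permEl (perm_sort _ _))) /= big_enum.
rewrite eseqE /weight actE -[X in (_ = t * X)%N]sum1_card -sum1_card !big_distrr /=.
rewrite [X in (_ + X + _)%N]big_mkcond [X in (_ + _ + X)%N]big_mkcond /=.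
rewrite -!big_split /=; apply: eq_bigr => e _; rewrite inE muln1.
case: (e \in _) => /=; first by rewrite subnK ?addn0.
by case: (dep _ _) => /=; rewrite !addn0.
Qed.

Lemma labs_eseqE : [seq word l | l <- enum (labelled_forest G t)] =i
  labs lo hi t id eseq.
Proof.
move=> w; apply/mapP/idP => [[l]|].
  by rewrite mem_enum => lF ->; rewrite (labs_eseq l).1.
move=> wl; have ws := size_labs wl.
(* This bound makes [inord] below faithful. *)
have w_le : all (fun j => j <= t)%N w.
  elim: eseq (id) w wl {ws} => [|e s IHs] r w.
    by rewrite mem_labs_nil => /eqP->.
  case: w => [|j w]; first by move/size_labs.
  rewrite mem_labs_cons => /andP[jc /IHs wle] /=; rewrite wle andbT.
  move: jc; rewrite /choices; case: ifP => _; first by rewrite inE => /eqP->.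
  by rewrite mem_iota ltnS.
pose l : {ffun edge G -> 'I_t.+1} := [ffun e => inord (nth 0%N w (index e eseq))].
have wE : w = word l.
  apply: (@eq_from_nth _ 0%N) => [|i iw]; first by rewrite size_map ws.
  have ie : (i < size eseq)%N by rewrite -ws.
  case es : eseq ie => [//|e0 s'] ie; rewrite -es in ie *.
  rewrite (nth_map e0) // ffunE index_uniq ?eseq_uniq // inordK // ltnS.
  by apply: (allP w_le); apply: mem_nth.
by exists l; rewrite // mem_enum -(labs_eseq l).1 -wE.
Qed.

Lemma big_labs_eseq (R : Type) (idx : R) (op : Monoid.com_law idx)
    (P : seq nat -> R) :
  \big[op/idx]_(w <- labs lo hi t id eseq) P w =
    \big[op/idx]_(l in labelled_forest G t) P (word l).
Proof.
rewrite -big_enum -[RHS](big_map word xpredT P).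
apply: perm_big; apply: uniq_perm; rewrite ?labs_uniq //.
  by rewrite (map_inj_uniq word_inj) enum_uniq.
by move=> w; rewrite -labs_eseqE.
Qed.

End Activity.

(** * Duality *)

Section Presentations.
Variables (K : fieldType) (n : nat) (I : finType) (g : relations K n I).

Lemma presented_pi_eq0 p : (presented_pi g p == 0) = (p \in gen_ideal g).
Proof.
rewrite -[0](rmorph0 (presented_pi g)) /presented_pi /alg_quot_pi.
by rewrite -Quotient.idealrBE subr0.
Qed.

Lemma presented_pi_surj x : exists p, x = presented_pi g p.
Proof. by exists (repr x); rewrite /presented_pi /alg_quot_pi reprK. Qed.

Lemma relator_gen_ideal i p : g i * p \in gen_ideal g.
Proof.
rewrite mulrC; apply/asboolP; exists (fun j => if j == i then p else 0).
rewrite (bigD1 i) //= eqxx big1 ?addr0 // => j /negPf ->.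
by rewrite mul0r.
Qed.

End Presentations.

Lemma has_dim_finset (K : fieldType) (V : lmodType K) (U : V -> Prop)
    (T : finType) (A : {set T}) (b : T -> V) :
    (forall c : T -> K, \sum_(x in A) c x *: b x = 0 ->
       forall x, x \in A -> c x = 0) ->
    (forall v, U v <-> exists c : T -> K, v = \sum_(x in A) c x *: b x) ->
  has_dim U #|A|.
Proof.
move=> indep span; exists (fun i => b (enum_val i)).
have sumE (c : 'I_#|A| -> K) : exists2 c' : T -> K, forall i, c' (enum_val i) = c i
    & \sum_i c i *: b (enum_val i) = \sum_(x in A) c' x *: b x.
  (* Each fibre has at most one element, so this extends [c] by zero outside [A]. *)
  pose c' x := \sum_(i | enum_val i == x) c i.
  have c'E i : c' (enum_val i) = c i.
    rewrite /c' (big_pred1 i) // => j.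
    by rewrite (inj_eq enum_val_inj).
  exists c' => //; rewrite [RHS]big_enum_val.
  by apply: eq_bigr => i _; rewrite c'E.
split=> [c|v].
  have [c' c'E ->] := sumE c; move=> /indep c0 i.
  by rewrite -c'E c0 // enum_valP.
split=> [/span[c ->]|[c ->]].
  by exists (fun i => c (enum_val i)); rewrite [LHS]big_enum_val.
by have [c' _ ->] := sumE c; apply/span; exists c'.
Qed.

(** A matrix of maximal rank among those with rows in [S] has row space [S]; some column of its
    cokernel then kills [S] but not [v]. *)
Lemma rV_separation (K : fieldType) N (S : 'rV[K]_N -> Prop) v :
    S 0 -> (forall a u w, S u -> S w -> S (a *: u + w)) -> ~ S v ->
  exists w : 'cV_N, (forall u, S u -> u *m w = 0) /\ v *m w != 0.
Proof.
move=> S0 Slin Sv.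
have Smul (A : 'M_N) (SA : forall i, S (row i A)) u : (u <= A)%MS -> S u.
  case/submxP => a ->; rewrite mulmx_sum_row.
  elim: (index_enum _) => [|i s IHs]; first by rewrite big_nil.
  by rewrite big_cons; apply: Slin.
pose P r := `[< exists A : 'M[K]_N, (forall i, S (row i A)) /\ \rank A = r >].
have exP : exists r, P r.
  by exists 0%N; apply/asboolP; exists 0; split=> [i|]; rewrite ?row0 ?mxrank0.
have leP r : P r -> (r <= N)%N.
  by move/asboolP => [A [_ <-]]; apply: rank_leq_row.
case: (ex_maxnP exP leP) => _ /asboolP[A [SA <-]] maxA.
have SleA u : S u -> (u <= A)%MS.
  move=> Su; have /maxA : P (\rank (A + u)%MS).
    apply/asboolP; exists (A + u)%MS; split=> // i.
    have /sub_addsmxP[[a b] /= ->] := row_sub i (A + u)%MS.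
    rewrite [b]mx11_scalar mul_scalar_mx addrC; apply: Slin => //.
    by apply: (Smul A SA); apply: submxMl.
  have /mxrank_leqif_sup := addsmxSl A u.
  case=> leA eqA le_rank; apply: submx_trans (addsmxSr A u) _.
  by rewrite -eqA eqn_leq leA.
have : ~~ (v <= A)%MS by apply/negP => /(Smul A SA).
rewrite submxE => /rV0Pn[j vj]; exists (col j (cokermx A)); split=> [u /SleA|].
  by rewrite submxE => /eqP uA; rewrite colE mulmxA uA mul0mx.
rewrite colE mulmxA -colE; apply/eqP => /colP/(_ 0).
by rewrite !mxE => v0; case/eqP: vj; rewrite -v0 !mxE.
Qed.

(** * Separation and dual families for the pairing *)

Section PairingDuality.
Variables (K : fieldType) (n : nat).
Hypothesis charK : [pchar K] =i pred0.
Implicit Types (p q f y : {mpoly K[n]}).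

Lemma mfact_neq0 (m : 'X_{1..n}) : (mfact m)%:R != 0 :> K.
Proof.
rewrite natr_eq0 // -lt0n /mfact; apply: prodn_gt0 => i.
exact: fact_gt0.
Qed.

Lemma pair_sym p q : pair p q = pair q p.
Proof.
pose k := maxn (msize p) (msize q).
rewrite !(@pairwE _ _ k) ?leq_max ?leqnn ?orbT //.
by apply: eq_bigr => m _; rewrite [p@_m * _]mulrC.
Qed.

Lemma pair_homog0 p f d e :
  p \is d.-homog -> f \is e.-homog -> d != e -> pair p f = 0.
Proof.
move=> pd fe nde; rewrite /pair big_seq big1 // => m mp.
by rewrite (dhomog_nemf_coeff fe) ?mulr0 ?mul0r // (dhomog_mf pd mp).
Qed.

Lemma pair_pihomog p f d : f \is d.-homog ->
  pair (pihomog mdeg d p) f = pair p f.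
Proof.
move=> fd; rewrite pihomogE pair_suml /pair big_mkcond; apply: eq_bigr => m _.
rewrite -/(pair _ _) pairZl pairX mulrA; case: eqP => // /eqP md.
by rewrite (dhomog_nemf_coeff fd) // mulr0 mul0r.
Qed.

Section Coordinates.
Variable D : nat.
Local Notation N := #|{: 'X_{1..n < D}}|.

Definition coords q : 'rV[K]_N := \row_j q@_(enum_val j : 'X_{1..n < D}).

Definition of_coords (u : 'rV[K]_N) : {mpoly K[n]} :=
  \sum_j u 0 j *: 'X_[(enum_val j : 'X_{1..n < D})].

(** Dividing by the factorials turns the pairing into a row-by-column product. *)
Definition of_dual_coords (w : 'cV[K]_N) : {mpoly K[n]} :=
  \sum_j (w j 0 / (mfact (enum_val j : 'X_{1..n < D}))%:R) *:
    'X_[(enum_val j : 'X_{1..n < D})].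

Lemma coordsK q : (msize q <= D)%N -> of_coords (coords q) = q.
Proof.
move=> qD; rewrite [RHS](mpolywE qD) (reindex (@enum_val _ predT)) /=.
  by apply: eq_bigr => j _; rewrite mxE.
by apply: onW_bij; apply: enum_val_bij.
Qed.

Lemma pair_of_dual_coords q w : pair q (of_dual_coords w) = (coords q *m w) 0 0.
Proof.
rewrite linear_sum /= mxE; apply: eq_bigr => j _.
rewrite linearZ /= pair_sym pairX mxE mulrCA divfK ?mfact_neq0 //.
Qed.

Lemma pair_high_degree q w d : q \is d.-homog -> (D <= d)%N ->
  pair q (of_dual_coords w) = 0.
Proof.
move=> qd leDd; rewrite linear_sum big1 //= => j _; rewrite linearZ /=.
rewrite pair_sym pairX (dhomog_nemf_coeff qd) ?mul0r ?mulr0 //.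
by rewrite ltn_eqF // (leq_trans (bmdeg _)).
Qed.

End Coordinates.

Lemma pair_separation (J : {mpoly K[n]} -> Prop) p D :
    J 0 -> (forall a q r, J q -> J r -> J (a *: q + r)) ->
    (msize p <= D)%N -> ~ J p ->
  exists2 w,
    forall q, (msize q <= D)%N -> J q -> pair q (of_dual_coords (D := D) w) = 0
    & pair p (of_dual_coords w) != 0.
Proof.
move=> J0 Jlin pD Jp.
have [|a u w Ju Jw||w [Sw pw]] :=
    @rV_separation K _ (fun u => J (of_coords (D := D) u)) (coords D p).
- by rewrite /of_coords big1 // => j _; rewrite mxE scale0r.
- have -> : of_coords (a *: u + w) = a *: of_coords u + of_coords w.
    rewrite /of_coords scaler_sumr -big_split; apply: eq_bigr => j _ /=.
    by rewrite !mxE scalerDl scalerA.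
  exact: Jlin.
- by rewrite coordsK.
exists w => [q qD Jq|]; rewrite pair_of_dual_coords.
  by rewrite Sw ?mxE // coordsK.
apply: contraNneq pw => pw0; apply/eqP/matrixP => i j.
by rewrite !ord1 pw0 mxE.
Qed.

(** Independence gives the coefficient matrix a right inverse, whose columns are dual vectors.
    Projecting each to degree [d x] keeps its pairings in that degree, and those with forms of other
    degrees are zero on both sides. *)
Lemma dual_family (T : finType) (A : {set T}) (f : T -> {mpoly K[n]})
    (d : T -> nat) :
    (forall x, f x \is (d x).-homog) ->
    (forall c : T -> K, \sum_(x in A) c x *: f x = 0 ->
       forall x, x \in A -> c x = 0) ->
  exists2 p : T -> {mpoly K[n]}, forall x, p x \is (d x).-homog
    & {in A &, forall x z, pair (p x) (f z) = (x == z)%:R}.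
Proof.
move=> fd indep; pose D := \max_x msize (f x).
have fD x : (msize (f x) <= D)%N by apply: leq_bigmax.
pose M := \matrix_i coords D (f (enum_val i : T)) : 'M_(#|A|, _).
have /row_freeP[B MB] : row_free M.
  rewrite -kermx_eq0; apply/eqP/row_matrixP => i; rewrite row0.
  set u := row i _; have uM : u *m M = 0.
    by apply/sub_kermxP; apply: row_sub.
  clearbody u => {i}; pose c x := \sum_(j | enum_val j == x) u 0 j.
  have cE j : c (enum_val j) = u 0 j.
    rewrite /c (big_pred1 j) // => j'.
    by rewrite (inj_eq enum_val_inj).
  apply/rowP => j; rewrite -cE [RHS]mxE; apply: indep (enum_valP j).
  rewrite big_enum_val /= -[LHS](@coordsK D).
    rewrite -[RHS](@coordsK D) ?msize0 //; congr of_coords.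
    transitivity (u *m M).
      apply/rowP => k; rewrite !mxE raddf_sum; apply: eq_bigr => j' _.
      by rewrite /= mcoeffZ cE !mxE.
    by rewrite uM; apply/rowP => k; rewrite !mxE mcoeff0.
  apply: leq_trans (msize_sum _ _ _) _; apply/bigmax_leqP_seq => j' _ _.
  exact: leq_trans (msizeZ_le _ _) (fD _).
pose p x := \sum_(i | enum_val i == x) of_dual_coords (col i B).
exists (fun x => pihomog mdeg (d x) (p x)) => [x|x y xA yA].
  exact: pihomogP.
have pE i : p (enum_val i) = of_dual_coords (col i B).
  rewrite /p (big_pred1 i) // => j.
  by rewrite (inj_eq enum_val_inj).
have pairE : pair (p x) (f y) = (x == y)%:R.
  rewrite -(enum_rankK_in xA xA) -(enum_rankK_in xA yA) pE pair_sym.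
  rewrite pair_of_dual_coords (inj_eq enum_val_inj).
  set i := enum_rank_in _ x; set j := enum_rank_in _ y.
  have /matrixP/(_ j i) := MB; rewrite !mxE [i == j]eq_sym => <-.
  by apply: eq_bigr => k _; rewrite !mxE.
case: (eqVneq (d x) (d y)) => [dxy|ndxy]; first by rewrite dxy pair_pihomog.
rewrite (pair_homog0 (pihomogP _ _ _) (fd y) ndxy).
by case: (eqVneq x y) ndxy => // ->; rewrite eqxx.
Qed.

End PairingDuality.

(** * The evaluation map *)

Lemma expr_add_nilp (R : comNzRingType) (u v : R) a b :
  u ^+ a.+1 = 0 -> v ^+ b.+1 = 0 -> (u + v) ^+ (a + b).+1 = 0.
Proof.
move=> ua vb; rewrite exprDn big1 // => i _.
case: (leqP i b) => [leib|ltbi].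
  have -> : ((a + b).+1 - i = (b - i) + a.+1)%N by lia.
  by rewrite exprD ua mulr0 mul0r mul0rn.
by rewrite -(subnK ltbi) [v ^+ _]exprD vb !mulr0 mul0rn.
Qed.

Lemma expr_sum_nilp (R : comNzRingType) (T : eqType) (s : seq T) (P : pred T)
    (u : T -> R) t :
  (forall x, u x ^+ t.+1 = 0) -> (\sum_(x <- s | P x) u x) ^+ (t * count P s).+1 = 0.
Proof.
move=> ut; elim: s => [|x s IHs]; first by rewrite big_nil expr0n.
rewrite big_cons /=; case: (P x); last by rewrite add0n.
by rewrite mulnDr muln1; apply: expr_add_nilp.
Qed.

Section Algebras.
Variables (K : fieldType) (n : nat) (G : graph n) (t : nat).

Local Notation lo := (@lo n G).
Local Notation hi := (@hi n G).

Lemma coefE i (e : edge G) :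
  coef K i e = (lo e == i)%:R - (hi e == i)%:R.
Proof.
have ltlh := lo_lt_hi e; rewrite /coef.
have -> : [exists j, (ends e == [set i; j]) && (i < j)%N] = (lo e == i).
  apply/existsP/eqP => [[j /andP[/eqP/ends_eq2[] [-> ej]]]//|<-].
    by rewrite ej ltnNge ltnW.
  by exists (hi e); rewrite endsE eqxx.
have -> : [exists j, (ends e == [set i; j]) && (j < i)%N] = (hi e == i).
  apply/existsP/eqP => [[j /andP[/eqP/ends_eq2[] [-> ej]]]//|<-].
    by rewrite ej ltnNge ltnW.
  by exists (lo e); rewrite endsE setUC eqxx.
case: eqP => [<-|_]; first by rewrite eq_sym (negPf (lo_neq_hi e)) subr0.
by case: eqP; rewrite sub0r ?oppr0.
Qed.

(** The two ends of an edge inside [I] cancel, so the sum of the [X_i] over [I] involves only the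
    edges of the cut. *)
Lemma sum_coefE (I : {set 'I_n}) (e : edge G) :
  \sum_(i in I) coef K i e = (lo e \in I)%:R - (hi e \in I)%:R.
Proof.
under eq_bigr => i _ do rewrite coefE.
have sumE x : \sum_(i in I) (x == i)%:R = (x \in I)%:R :> K.
  case: (boolP (x \in I)) => xI.
    rewrite (bigD1 x) //= eqxx big1 ?addr0 // => i /andP[_ /negPf].
    by rewrite eq_sym => ->.
  by rewrite big1 // => i iI; case: eqP xI => // ->; rewrite iI.
by rewrite sumrB !sumE.
Qed.

Lemma crossE (I : {set 'I_n}) (e : edge G) :
  (ends e :&: I != set0) && (ends e :&: ~: I != set0) = separates (lo e) (hi e) I.
Proof.
have meetE (A : {set 'I_n}) : (ends e :&: A != set0) = (lo e \in A) || (hi e \in A).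
  apply/set0Pn/orP => [[x]|[xA|xA]].
  - by rewrite endsE => /setIP[/set2P[] ->]; [left|right].
  - by exists (lo e); rewrite inE xA endsE set21.
  - by exists (hi e); rewrite inE xA endsE set22.
rewrite !meetE !inE /separates.
by case: (lo e \in I); case: (hi e \in I).
Qed.

Lemma cut_eseq (le : rel (edge G)) I : cut lo hi id (eseq le) I = cut_size G I.
Proof.
rewrite /cut /eseq (perm_big _ (permEl (perm_sort _ _))) /= big_enum /=.
rewrite /cut_size -sum1_card [RHS]big_mkcond; apply: eq_bigr => e _.
by rewrite inE crossE; case: separates.
Qed.

Local Notation edge_rel := (Relations (@edge_relator0 K n G t)).
Local Notation power_rel := (Relations (@power_relator0 K n G t)).
Local Notation coefs := (fun i k => coef K i (enum_val k : edge G)).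

Definition eval_Phi (p : {mpoly K[n]}) : Phi K G t :=
  presented_pi edge_rel (p \mPo fwd coefs).

Fact eval_Phi_is_linear : linear eval_Phi.
Proof. by move=> a p q; rewrite /eval_Phi !linearP. Qed.

Fact eval_Phi_is_monoid_morphism : monoid_morphism eval_Phi.
Proof.
by split=> [|p q]; rewrite /eval_Phi ?rmorph1 // !rmorphM.
Qed.

HB.instance Definition _ := GRing.isLinear.Build K _ _ _ eval_Phi
  eval_Phi_is_linear.
HB.instance Definition _ := GRing.isMonoidMorphism.Build _ _ eval_Phi
  eval_Phi_is_monoid_morphism.

Lemma eval_PhiX i : eval_Phi 'X_i = Xgen K G t i.
Proof.
rewrite /eval_Phi comp_mpolyXU -tnth_nth tnth_mktuple linear_sum /Xgen /=.
rewrite (reindex enum_rank); last exact: onW_bij (enum_rank_bij _).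
by apply: eq_bigr => e _; rewrite linearZ /= enum_rankK.
Qed.

Lemma phi_nilp (e : edge G) : phi K t e ^+ t.+1 = 0.
Proof.
rewrite /phi -rmorphXn /=; apply/eqP; rewrite presented_pi_eq0.
by rewrite -[_ ^+ _]mulr1; apply: (relator_gen_ideal edge_rel e).
Qed.

(** A combination of [D_I] commuting elements with zero [t.+1]-st power has zero power
    [(t * D_I).+1]. *)
Lemma eval_Phi_power_relator p : p \in gen_ideal power_rel -> eval_Phi p = 0.
Proof.
move/asboolP => [a ->]; rewrite linear_sum big1 // => I _.
rewrite /= rmorphM /= /power_relator rmorphXn /= linear_sum /=.
under eq_bigr => i _ do rewrite eval_PhiX.
rewrite /Xgen exchange_big /=.
pose P (e : edge G) := separates (lo e) (hi e) (sval I).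
have -> : \sum_e \sum_(i in sval I) coef K i e *: phi K t e =
    \sum_(e <- index_enum (edge G) | P e)
       (\sum_(i in sval I) coef K i e) *: phi K t e.
  rewrite [RHS]big_mkcond; apply: eq_bigr => e _; rewrite -scaler_suml.
  rewrite sum_coefE /P /separates; case: (_ \in _); case: (_ \in _) => //=;
  by rewrite subrr scale0r.
have -> : cut_size G (sval I) = count P (index_enum (edge G)).
  rewrite -sum1_count /cut_size -sum1_card [RHS]big_mkcond [LHS]big_mkcond /=.
  by apply: eq_bigr => e _; rewrite inE crossE.
rewrite expr_sum_nilp ?mulr0 // => e.
by rewrite exprZn phi_nilp scaler0.
Qed.

Lemma mcoeff_edge_ideal p (b : 'X_{1..#|edge G|}) : p \in gen_ideal edge_rel ->
  (forall k, b k <= t)%N -> p@_b = 0.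
Proof.
move/asboolP => [a ->] bt; rewrite raddf_sum big1 //= => e _.
rewrite /edge_relator mpolyXn mcoeffM big1 // => -[k1 k2] /= /eqP ekb.
rewrite mcoeffX; case: eqP => [ek2|]; last by rewrite mulr0.
have /mnmP/(_ (enum_rank e)) := ekb; have := bt (enum_rank e).
rewrite mnmDE -ek2 mulmnE mnm1E eqxx mul1n => + eb.
by rewrite eb addnS ltnNge leq_addl.
Qed.

(** The support condition on [b] ensures that a new edge starts from exponent 0, which keeps all
    exponents at most [t]. *)
Lemma labprod_monomial r s w : uniq s ->
  exists b : 'X_{1..#|edge G|},
    [/\ forall k, (b k <= t)%N, forall k, enum_val k \notin s -> b k = 0%N
      & labprod lo hi t K id r s w = 'X_[b] \mPo bwd coefs].
Proof.
have nil_case s' : exists b : 'X_{1..#|edge G|},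
    [/\ forall k, (b k <= t)%N, forall k, enum_val k \notin s' -> b k = 0%N
      & 1 = 'X_[b] \mPo bwd coefs].
  exists 0%MM; split=> [k|k _|]; rewrite ?mnm0E //.
  by rewrite mpolyX0 comp_mpoly1.
elim: s r w => [|e s IHs] r w; first by move=> _; apply: nil_case.
rewrite cons_uniq => /andP[eNs Us]; case: w => [|j w] /=; first exact: nil_case.
have [b [bt bs ->]] := IHs (contract lo hi r e j) w Us.
have be : b (enum_rank e) = 0%N by apply: bs; rewrite enum_rankK.
exists (b + U_(enum_rank e) *+ expo lo hi t r e j)%MM; split=> [k|k|].
- rewrite mnmDE mulmnE mnm1E; case: eqP => [<-|_]; last by rewrite addn0.
  rewrite be mul1n /expo; case: ifP => // _; exact: leq_subr.
- rewrite inE negb_or => /andP[ke /bs b0]; rewrite mnmDE b0 mulmnE mnm1E.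
  case: eqP => // ek; by rewrite -ek enum_rankK eqxx in ke.
rewrite mpolyXD rmorphM /= mulrC -mpolyXn rmorphXn /= comp_mpolyXU -tnth_nth.
congr (_ * _ ^+ _); rewrite tnth_mktuple enum_rankK /form.
under eq_bigr => i _ do rewrite coefE scalerBl.
have sumX x : \sum_i (x == i)%:R *: 'X_i = 'X_x :> {mpoly K[n]}.
  rewrite (bigD1 x) //= eqxx scale1r big1 ?addr0 // => i /negPf.
  by rewrite eq_sym => ->; rewrite scale0r.
by rewrite sumrB !sumX.
Qed.

(** * Forest polynomials and the kernel of evaluation *)

Section ForestPolynomials.
Variable le : rel (edge G).

Definition forest_poly (l : {ffun edge G -> 'I_t.+1}) : {mpoly K[n]} :=
  labprod lo hi t K id id (eseq le) (word le l).

Definition forest_deg (l : {ffun edge G -> 'I_t.+1}) : nat :=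
  labdeg lo hi t id (eseq le) (word le l).

(** By adjointness the pairing is, up to a factorial, a coefficient of [p \mPo fwd] at a monomial
    with exponents at most [t]; the edge ideal has none. *)
Lemma pair_eval_Phi p l : eval_Phi p = 0 -> pair p (forest_poly l) = 0.
Proof.
move=> /eqP; rewrite presented_pi_eq0 => pJ.
have [b [bt _ eb]] := labprod_monomial id (word le l) (eseq_uniq le).
rewrite /forest_poly eb -pair_adjoint pair_sym pairX.
by rewrite (mcoeff_edge_ideal pJ) ?mul0r.
Qed.

Hypothesis charK : [pchar K] =i pred0.
Hypothesis le_order : linear_order le.

Lemma forest_poly_indep (c : {ffun edge G -> 'I_t.+1} -> K) :
    \sum_(l in labelled_forest G t) c l *: forest_poly l = 0 ->
  forall l, l \in labelled_forest G t -> c l = 0.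
Proof.
move=> sum0 l lF.
(* Coefficients move from labellings to words by summing over fibres of the injective map [word]. *)
have wK l' : l' \in labelled_forest G t ->
    (\sum_(l'' in labelled_forest G t | word le l'' == word le l') c l'') = c l'.
  move=> l'F; rewrite (big_pred1 l') // => l''.
  rewrite /= (inj_eq (@word_inj _ _ _ _)).
  by case: (eqVneq l'' l') => [->|_]; rewrite ?andbF // l'F.
rewrite -wK //.
apply: (@labprod_indep K n _ lo hi t id (eseq le)
  (fun w => \sum_(l'' in labelled_forest G t | word le l'' == w) c l'')).
  rewrite (big_labs_eseq le_order) -[RHS]sum0.
  by apply: eq_bigr => l' l'F; rewrite wK.
by rewrite (labs_eseq le_order l).1.
Qed.

(* A polynomial orthogonal to all the forest polynomials lies in the ideal:
   otherwise some y separates it from the part of bounded degree of the ideal,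
   and y satisfies the conditions of labprod_span. *)
Lemma power_ideal_orthogonal p :
    (forall l, l \in labelled_forest G t -> pair p (forest_poly l) = 0) ->
  p \in gen_ideal power_rel.
Proof.
move=> p_orth; apply: contraT => /negP Jp.
have J_lin a q r : q \in gen_ideal power_rel -> r \in gen_ideal power_rel ->
    a *: q + r \in gen_ideal power_rel.
  by move=> Jq Jr; rewrite rpredD // -mul_mpolyC; apply: idealMr.
have [w Jw /eqP[]] := pair_separation charK (rpred0 _) J_lin (leqnn (msize p)) Jp.
set y := of_dual_coords w in Jw *.
have : inQ (fun I => t * cut lo hi id (eseq le) I)%N y.
  (* The empty set has no relator, but the derivative along it is zero. *)
  move=> I; rewrite cut_eseq; case: (eqVneq I set0) => [->|I0].
    by rewrite diterS /dset big_set0.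
  apply/mpolyP => m; rewrite mcoeff0; apply/eqP.
  rewrite -(mulIr_eq0 _ (mulIf (mfact_neq0 charK m))) -pairX -pair_mul_dset.
  have XI : (\sum_(i in I) 'X_i : {mpoly K[n]}) \is 1.-homog.
    by rewrite rpred_sum // => i _; rewrite dhomogX; apply/eqP; exact: mdeg1.
  have Xm : ('X_[m] : {mpoly K[n]}) \is (mdeg m).-homog by rewrite dhomogX /=.
  have := dhomogM (dhomogMn (t * cut_size G I).+1 XI) Xm.
  set q := _ * _; set d := (_ + _)%N => qd.
  (* A relator times a monomial is homogeneous: either its degree is out of the range of [y], or its
     size is bounded and [Jw] applies. *)
  case: (leqP (msize p) d) => [le_pd|lt_dp].
    by rewrite (pair_high_degree w qd).
  rewrite Jw //.
    apply: leq_trans lt_dp; rewrite msizeE; apply/bigmax_leqP_seq => m' m'q _.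
    by rewrite (dhomog_mf qd m'q).
  exact: (relator_gen_ideal power_rel (exist _ I I0)).
move/(labprod_span charK) => [c ->].
rewrite (big_labs_eseq le_order) linear_sum big1 //= => l /p_orth pl.
by rewrite linearZ /= -/(forest_poly l) pl mulr0.
Qed.

(** The circle closes: the ideal lies in the kernel, the kernel is orthogonal to the forest
    polynomials, and that orthogonal lies in the ideal. *)
Lemma eval_Phi_eq0 p : (eval_Phi p == 0) = (p \in gen_ideal power_rel).
Proof.
apply/eqP/idP => [p0|]; last exact: eval_Phi_power_relator.
by apply: power_ideal_orthogonal => l _; apply: pair_eval_Phi.
Qed.

End ForestPolynomials.

(** * The isomorphism induced by evaluation *)

Section Isomorphism.

Lemma eval_Phi_in_gen_subalg p : eval_Phi p \in gen_subalg (Xgen K G t).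
Proof.
elim/mpoly_ring_ind: p => [c|p q IHp IHq|i p IHp].
- by rewrite -alg_mpolyC linearZ /= rmorph1 rpredZ // rpred1.
- by rewrite rmorphD rpredD.
rewrite rmorphM rpredM //= eval_PhiX; apply/asboolP => S _; exact.
Qed.

Definition Balg_to_Calg (x : Balg K G t) : Calg K G t :=
  SubalgOf (eval_Phi_in_gen_subalg (repr x)).

Lemma Balg_to_Calg_pi p :
  val (Balg_to_Calg (presented_pi power_rel p)) = eval_Phi p.
Proof.
rewrite /=; apply/eqP; rewrite -subr_eq0 -linearB; apply/eqP.
apply: eval_Phi_power_relator; by rewrite Quotient.idealrBE reprK.
Qed.

Fact Balg_to_Calg_is_linear : linear Balg_to_Calg.
Proof.
move=> a x y; apply: val_inj.
have [p ->] := presented_pi_surj x; have [q ->] := presented_pi_surj y.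
rewrite -linearP Balg_to_Calg_pi [LHS]linearP /=.
by rewrite -(Balg_to_Calg_pi p) -(Balg_to_Calg_pi q).
Qed.

Fact Balg_to_Calg_is_monoid_morphism : monoid_morphism Balg_to_Calg.
Proof.
split=> [|x y]; apply: val_inj.
  by rewrite -(rmorph1 (presented_pi power_rel)) Balg_to_Calg_pi !rmorph1.
have [p ->] := presented_pi_surj x; have [q ->] := presented_pi_surj y.
rewrite -rmorphM Balg_to_Calg_pi [LHS]rmorphM /=.
by rewrite -(Balg_to_Calg_pi p) -(Balg_to_Calg_pi q).
Qed.

HB.instance Definition _ := GRing.isLinear.Build K _ _ _ Balg_to_Calg
  Balg_to_Calg_is_linear.
HB.instance Definition _ := GRing.isMonoidMorphism.Build _ _ Balg_to_Calg
  Balg_to_Calg_is_monoid_morphism.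

Lemma Balg_to_Calg_surj y : exists x, Balg_to_Calg x = y.
Proof.
case: y => z zC.
(* The image of [eval_Phi] is a subalgebra containing the generators. *)
suff /asboolP[p pz] : z \in (fun z => `[< exists p, eval_Phi p = z >]).
  exists (presented_pi power_rel p); apply: val_inj.
  by rewrite Balg_to_Calg_pi.
move/asboolP: (zC); apply=> [|i]; last first.
  by apply/asboolP; exists 'X_i; apply: eval_PhiX.
split=> [|a u v /asboolP[p <-] /asboolP[q <-]|u v /asboolP[p <-] /asboolP[q <-]].
- by apply/asboolP; exists 1; rewrite rmorph1.
- by apply/asboolP; exists (a *: p + q); rewrite linearP.
- by apply/asboolP; exists (p * q); rewrite rmorphM.
Qed.

End Isomorphism.
End Algebras.

(** * Dimensions *)

Lemma has_dim_bij (K : fieldType) (V W : lmodType K) (f : {linear V -> W}) d :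
  bijective f -> has_dim (fun _ : V => True) d -> has_dim (fun _ : W => True) d.
Proof.
move=> [g fK gK] [b [indep span]]; exists (fun i => f (b i)).
have fE (c : 'I_d -> K) : \sum_i c i *: f (b i) = f (\sum_i c i *: b i).
  by rewrite linear_sum; apply: eq_bigr => i _; rewrite linearZ.
split=> [c|w]; last first.
  split=> // _; have [/(_ I)[c gw] _] := span (g w).
  by exists c; rewrite fE -gw gK.
by rewrite fE => f0; apply: indep; apply: (can_inj fK); rewrite f0 linear0.
Qed.

Section Dimensions.
Variables (K : fieldType) (n : nat) (G : graph n) (t : nat).
Hypothesis charK : [pchar K] =i pred0.

Local Notation power_rel := (Relations (@power_relator0 K n G t)).

Section Order.
Variable le : rel (edge G).
Hypothesis le_order : linear_order le.

Lemma Balg_to_Calg_inj : injective (@Balg_to_Calg K n G t).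
Proof.
apply: raddf_inj => x; have [p ->] := presented_pi_surj x.
move/(congr1 val); rewrite Balg_to_Calg_pi /= => /eqP.
by rewrite (eval_Phi_eq0 t charK le_order) -presented_pi_eq0 => /eqP.
Qed.

Lemma Balg_to_Calg_bij : bijective (@Balg_to_Calg K n G t).
Proof.
pose g y := projT1 (cid (@Balg_to_Calg_surj K n G t y)).
have gK y : Balg_to_Calg (g y) = y by rewrite /g; case: cid.
by exists g => // x; apply: Balg_to_Calg_inj; rewrite gK.
Qed.

(** The predicate [P] covers the whole algebra and a single degree at once. The basis is the image
    of the family dual to the forest polynomials. *)
Lemma has_dim_homog (P : pred nat) :
  has_dim (fun x : Balg K G t => exists2 p : {mpoly K[n]},
      forall m, m \in msupp p -> P (mdeg m) & x = presented_pi power_rel p)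
    #|[set l in labelled_forest G t | P (forest_deg le l)]|.
Proof.
pose f := @forest_poly K n G t le.
have fd l : f l \is (forest_deg le l).-homog by apply: labprod_homog.
have [p pd pf] := dual_family charK fd (@forest_poly_indep K n G t le le_order).
set A := [set l in _ | _].
have AF l : l \in A -> l \in labelled_forest G t by rewrite inE => /andP[].
have pair_sumE (c : {ffun edge G -> 'I_t.+1} -> K) l : l \in labelled_forest G t ->
    pair (\sum_(l' in A) c l' *: p l') (f l) = if l \in A then c l else 0.
  move=> lF; rewrite pair_suml; case: ifPn => [lA|lNA].
    rewrite (bigD1 l) //= pairZl pf // eqxx mulr1 big1 ?addr0 // => l'.
    case/andP => l'A nl'.
    by rewrite pairZl (pf _ _ (AF _ l'A) lF) (negPf nl') mulr0.
  apply: big1 => l' l'A; rewrite pairZl (pf _ _ (AF _ l'A) lF).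
  by case: eqP l'A lNA => [-> ->//|]; rewrite mulr0.
have pi_sumE (a : {ffun edge G -> 'I_t.+1} -> K) :
    \sum_(l in A) a l *: (presented_pi power_rel (p l) : Balg K G t) =
    presented_pi power_rel (\sum_(l in A) a l *: p l).
  by rewrite linear_sum; apply: eq_bigr => l _; rewrite linearZ.
apply: (has_dim_finset (b := fun l => presented_pi power_rel (p l))) => [c|x].
  rewrite pi_sumE => /eqP; rewrite presented_pi_eq0 => sumJ l lA.
  have := pair_eval_Phi le l (eval_Phi_power_relator sumJ).
  by rewrite pair_sumE ?AF // lA.
split=> [[q qP ->]|[c ->]]; last first.
  rewrite pi_sumE; eexists; last by [].
  move=> m; rewrite mcoeff_msupp; apply: contraNT => nPm.
  rewrite raddf_sum big1 //= => l; rewrite inE => /andP[_ Pl].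
  rewrite mcoeffZ (dhomog_nemf_coeff (pd l)) ?mulr0 //.
  by apply: contraNneq nPm => ->.
(* With these coefficients the difference is orthogonal to every forest polynomial: inside [A] by
   duality, outside because the degrees differ. *)
exists (fun l => pair q (f l)); rewrite pi_sumE; apply/eqP.
rewrite -subr_eq0 -linearB presented_pi_eq0.
apply: (power_ideal_orthogonal charK le_order) => l lF.
rewrite pairBl pair_sumE //; case: ifPn => [_|]; first by rewrite subrr.
rewrite inE lF /= => nPl; rewrite subr0 /pair big_seq big1 // => m /qP Pm.
rewrite (dhomog_nemf_coeff (fd l)) ?mulr0 ?mul0r //.
by apply: contraNneq nPl => <-.
Qed.

Lemma has_dim_Balg : has_dim (fun _ : Balg K G t => True) #|labelled_forest G t|.
Proof.
have := has_dim_homog predT.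
have -> : [set l in labelled_forest G t | predT (forest_deg le l)] =
    labelled_forest G t by apply/setP => l; rewrite inE andbT.
case=> b [indep span]; exists b; split=> // x; split=> // _; apply/span.
by have [p ->] := presented_pi_surj x; exists p.
Qed.

(** The identity of [labs_eseq] turns [forest_deg le l = k] into the weight equation, stated over
    the integers to avoid truncated subtraction. *)
Lemma has_dim_Bgraded k :
  has_dim (@Bgraded K n G t k)
    #|[set l in labelled_forest G t |
        (weight l)%:Z == t%:Z * (#|edge G|%:Z - (act le (lsupport l))%:Z) - k%:Z]|.
Proof.
have [b [indep span]] := has_dim_homog (pred1 k).
have -> : [set l in labelled_forest G t |
        (weight l)%:Z == t%:Z * (#|edge G|%:Z - (act le (lsupport l))%:Z) - k%:Z]
    = [set l in labelled_forest G t | pred1 k (forest_deg le l)].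
  apply/setP => l; rewrite !inE; case: asboolP => //= /asboolP lF.
  have := (labs_eseq le_order l).2; rewrite inE lF => /(_ isT).
  rewrite -/(forest_deg le l) mulrBr -!PoszM => <-.
  by apply/eqP/eqP; lia.
exists b; split=> // x; rewrite -span.
split=> -[p ph ->]; exists p => //; last by apply/dhomogP => m /ph /eqP.
by move=> m /(dhomog_mf ph) /eqP.
Qed.

End Order.
End Dimensions.

Lemma exists_linear_order (n : nat) (G : graph n) :
  exists le : rel (edge G), linear_order le.
Proof.
exists (fun x y => (enum_rank x <= enum_rank y)%N); split=> [x y|x y|x y z].
- exact: leq_total.
- by rewrite -eqn_leq => /eqP/val_inj/enum_rank_inj.
- exact: leq_trans.
Qed.

Theorem mainTheorem4 (K : fieldType) (n : nat) (G : graph n) (t : nat)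
    (charK : [pchar K] =i pred0) (t_gt0 : (0 < t)%N) :
  [/\ exists f : {lrmorphism Balg K G t -> Calg K G t}, bijective f,
      has_dim (fun _ : Balg K G t => True) #|labelled_forest G t|,
      has_dim (fun _ : Calg K G t => True) #|labelled_forest G t|
    & forall le : rel (edge G), linear_order le -> forall k : nat,
      has_dim (@Bgraded K n G t k)
        #|[set l in labelled_forest G t |
            (weight l)%:Z
              == t%:Z * (#|edge G|%:Z - (act le (lsupport l))%:Z) - k%:Z]| ].
Proof.
have [le0 le0_order] := exists_linear_order G.
have bij := @Balg_to_Calg_bij K n G t charK le0 le0_order.
have dimB := @has_dim_Balg K n G t charK le0 le0_order.
split=> [|||le le_order k].
- by exists (@Balg_to_Calg K n G t).
- exact: dimB.
- exact: has_dim_bij bij dimB.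
- exact: has_dim_Bgraded.
Qed.
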